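(* Let $K$ be an algebraically closed field, let $X\in{}^aV^b$ and let $(\alpha,\beta,\gamma)$ be the triple of partitions associated with $X$. Then $$\dim\mathcal{O}_X=b^2+a^2-n(\alpha)-n(\beta)-n(\gamma)-b,$$ where for a partition $\lambda$ we set $n(\lambda)=\sum_i\lambda_i(i-1)$.
   Context: ${}^aV^b={}^aV^b(K)$ ($a\le b$ natural numbers) is the set of $(f,\varphi)\in\mathbb{M}_{b\times a}(K)\times\mathbb{M}_b(K)$ such that $\varphi^b=0$, $\varphi f=0$ and $f$ has maximal rank, with the induced Zariski topology. The group $\mathrm{Gl}(a,b)=\mathrm{Gl}(a)\times\mathrm{Gl}(b)$ acts by $(g,h)\cdot(f,\varphi)=(hfg^{-1},h\varphi h^{-1})$; $\mathcal{O}_X$ is the orbit of $X$. For a partition $\lambda=(\lambda_1\ge\lambda_2\ge\dots)$ put $N_\lambda=\bigoplus_iK[T]/(T^{\lambda_i})$. A point $X=(f,\varphi)\in{}^aV^b$ is identified with the triple $(N_\alpha,N_\beta,f)$, where $N_\beta$ is the $K[T]$-module $K^b$ on which $T$ acts by $\varphi$, $N_\alpha$ is $K^a$ with $T$ acting as zero (so $\alpha=(1,\dots,1)$ with $a$ parts), and $f:N_\alpha\to N_\beta$ is a $K[T]$-monomorphism. The triple of partitions associated with $X$ is $(\alpha,\beta,\gamma)$, where $\gamma$ is the partition with $\operatorname{Coker} f\simeq N_\gamma$. *)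

(* Defs.v *)
From HB Require Import structures.
From mathcomp Require Import all_boot all_order all_algebra.
From mathcomp Require Import mpoly.

Set Implicit Arguments.
Unset Strict Implicit.
Unset Printing Implicit Defensive.

Import GRing.Theory.
Local Open Scope ring_scope.
Local Open Scope quotient_scope.

(* Quotient modules: ring_quotient only provides the additive quotient group. *)
Section QuotientModule.

Variables (R : nzRingType) (V : lmodType R) (S : submodClosed V).

Lemma submod_oppr_closed : oppr_closed (S : {pred V}).
Proof. by move=> x Sx; rewrite -scaleN1r rpredZ. Qed.

Definition submod_zmod : {pred V} := S.

HB.instance Definition _ := GRing.SubmodClosed.on submod_zmod.
HB.instance Definition _ :=
  GRing.isOppClosed.Build V submod_zmod submod_oppr_closed.

Definition qmod := Quotient.quot submod_zmod.

HB.instance Definition _ := GRing.Zmodule.on qmod.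

Definition qmod_pi (x : V) : qmod := \pi_(Quotient.quot submod_zmod) x.

Definition qmod_scale (c : R) (x : qmod) : qmod := qmod_pi (c *: repr x).

Lemma qmod_piP (x y : V) : reflect (qmod_pi x = qmod_pi y) (x - y \in S).
Proof.
by rewrite (Quotient.idealrBE submod_zmod); apply: eqP.
Qed.

Lemma qmod_piW (P : qmod -> Prop) : (forall x, P (qmod_pi x)) -> forall x, P x.
Proof. by move=> Ppi; elim/quotW. Qed.

Lemma qmod_piD : {morph qmod_pi : x y / x + y}.
Proof. by move=> x y; rewrite /qmod_pi !piE. Qed.

Lemma qmod_scaleE c x : qmod_scale c (qmod_pi x) = qmod_pi (c *: x).
Proof.
apply/qmod_piP; rewrite -scalerBr rpredZ //; apply/qmod_piP.
exact: reprK.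
Qed.

Lemma qmod_scaleA c d x :
  qmod_scale c (qmod_scale d x) = qmod_scale (c * d) x.
Proof. by elim/qmod_piW: x => x; rewrite !qmod_scaleE scalerA. Qed.

Lemma qmod_scale1 : left_id 1 qmod_scale.
Proof. by elim/qmod_piW=> x; rewrite qmod_scaleE scale1r. Qed.

Lemma qmod_scaleDr : right_distributive qmod_scale +%R.
Proof.
move=> c; elim/qmod_piW=> x; elim/qmod_piW=> y.
by rewrite -qmod_piD !qmod_scaleE scalerDr qmod_piD.
Qed.

Lemma qmod_scaleDl x : {morph qmod_scale^~ x : c d / c + d}.
Proof.
by elim/qmod_piW: x => x c d; rewrite !qmod_scaleE scalerDl qmod_piD.
Qed.

HB.instance Definition _ := GRing.Zmodule_isLmodule.Build R qmod
  qmod_scaleA qmod_scale1 qmod_scaleDr qmod_scaleDl.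

Lemma qmod_pi_linear : linear qmod_pi.
Proof. by move=> c x y; rewrite qmod_piD -qmod_scaleE. Qed.

HB.instance Definition _ :=
  GRing.isLinear.Build R V qmod _ qmod_pi qmod_pi_linear.

End QuotientModule.

Arguments qmod {R V} S.

Definition lmod_iso (R : nzRingType) (U V : lmodType R) : Prop :=
  exists u : {linear U -> V}, bijective u.

(* The action of a polynomial p(T) on the module of an endomorphism phi.      *)
(* This is horner_mx phi p, which is only available for a size of the form    *)
(* n.+1.                                                                      *)
Definition poly_mx (K : fieldType) (n : nat) (phi : 'M[K]_n) (p : {poly K}) :
  'M[K]_n := \sum_(i < size p) p`_i *: phi ^+ i.

Section PolyMatrix.

Variables (K : fieldType) (n : nat) (phi : 'M[K]_n).

Lemma poly_mx_widen m (p : {poly K}) : (size p <= m)%N ->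
  poly_mx phi p = \sum_(i < m) p`_i *: phi ^+ i.
Proof.
move=> lepm; rewrite /poly_mx (big_ord_widen m (fun i => p`_i *: phi ^+ i)) //.
rewrite big_mkcond; apply: eq_bigr => i _; case: ltnP => // lepi.
by rewrite nth_default // scale0r.
Qed.

Lemma poly_mxD p q : poly_mx phi (p + q) = poly_mx phi p + poly_mx phi q.
Proof.
pose m := maxn (size p) (size q).
rewrite (@poly_mx_widen m) ?size_polyD // (@poly_mx_widen m p) ?leq_maxl //.
rewrite (@poly_mx_widen m q) ?leq_maxr // -big_split; apply: eq_bigr => i _ /=.
by rewrite coefD scalerDl.
Qed.

Lemma poly_mx1 : poly_mx phi 1 = 1%:M.
Proof.
by rewrite /poly_mx size_poly1 big_ord_recl big_ord0 addr0 coefC scale1r.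
Qed.

Lemma poly_mxM p q : poly_mx phi (p * q) = poly_mx phi p *m poly_mx phi q.
Proof.
case: n phi => [|m] psi; first by rewrite [LHS]flatmx0 [RHS]flatmx0.
suff E r : poly_mx psi r = horner_mx psi r by rewrite !E rmorphM.
rewrite -[r in RHS]coefK poly_def rmorph_sum; apply: eq_bigr => i _ /=.
by rewrite linearZ /= rmorphXn /= horner_mx_X.
Qed.

End PolyMatrix.

(* The K[T]-module K^n on which T acts by phi. The parameter phi only serves  *)
(* to select the module structure.                                            *)
Definition endmod (K : fieldType) (n : nat) (phi : 'M[K]_n) : Type := 'cV[K]_n.

Section ModuleOfEndomorphism.

Variables (K : fieldType) (n : nat) (phi : 'M[K]_n).
Local Notation endmod := (endmod phi).

HB.instance Definition _ := GRing.Zmodule.on endmod.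

Definition endmod_scale (p : {poly K}) (v : endmod) : endmod :=
  poly_mx phi p *m (v : 'cV[K]_n).

Lemma endmod_scaleA p q v :
  endmod_scale p (endmod_scale q v) = endmod_scale (p * q) v.
Proof. by rewrite /endmod_scale poly_mxM mulmxA. Qed.

Lemma endmod_scale1 : left_id 1 endmod_scale.
Proof. by move=> v; rewrite /endmod_scale poly_mx1 mul1mx. Qed.

Lemma endmod_scaleDr : right_distributive endmod_scale +%R.
Proof. by move=> p u v; rewrite /endmod_scale -mulmxDr. Qed.

Lemma endmod_scaleDl v : {morph endmod_scale^~ v : p q / p + q}.
Proof. by move=> p q; rewrite /endmod_scale poly_mxD mulmxDl. Qed.

HB.instance Definition _ := GRing.Zmodule_isLmodule.Build {poly K} endmod
  endmod_scaleA endmod_scale1 endmod_scaleDr endmod_scaleDl.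

Lemma endmod_scaleE (p : {poly K}) (v : endmod) :
  p *: v = poly_mx phi p *m (v : 'cV[K]_n).
Proof. by []. Qed.

End ModuleOfEndomorphism.

Section Nlambda.

Variable K : fieldType.

Section Ideal.

Variable m : nat.

Definition idealX : {pred {poly K}^o} := fun p => 'X^m %| (p : {poly K}).

Lemma idealX_submod : submod_closed idealX.
Proof.
split=> [|c p q]; rewrite /idealX ?unfold_in ?dvdp0 // => mp mq.
by rewrite dvdp_add // dvdp_mull.
Qed.

HB.instance Definition _ :=
  GRing.isSubmodClosed.Build {poly K} {poly K}^o idealX idealX_submod.

End Ideal.

(* The direct sum of the K[T]/(T^m), for m in lambda.                         *)
Fixpoint Nmod (lambda : seq nat) : lmodType {poly K} :=
  if lambda is m :: lambda' then (qmod (idealX m) * Nmod lambda')%type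
  else 'rV[{poly K}]_0.

End Nlambda.

Definition is_partition (lambda : seq nat) : bool :=
  sorted geq lambda && (0%N \notin lambda).

(* Parts are indexed from 0, so the weight of the part of index i is i and    *)
(* not i - 1.                                                                 *)
Definition npart (lambda : seq nat) : nat :=
  (\sum_(i < size lambda) nth 0 lambda i * i)%N.

Record aVb (K : fieldType) (a b : nat) := AVb {
  mor : 'M[K]_(b, a);
  endo : 'M[K]_b;
  endo_nilp : endo ^+ b = 0;
  endo_mor : endo *m mor = 0;
  mor_rank : \rank mor = minn b a }.

Section Cokernel.

Variables (K : fieldType) (a b : nat) (X : aVb K a b).

Local Notation Nalpha := (endmod (0 : 'M[K]_a)).
Local Notation Nbeta := (endmod (endo X)).

Definition mor_fun (v : Nalpha) : Nbeta := mor X *m (v : 'cV[K]_a).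

Lemma poly_mx_mor p :
  poly_mx (endo X) p *m mor X = mor X *m poly_mx (0 : 'M_a) p.
Proof.
rewrite /poly_mx mulmx_suml mulmx_sumr; apply: eq_bigr => i _.
rewrite -scalemxAl -scalemxAr; congr (_ *: _); case: (i : nat) => [|k].
  by rewrite !expr0 mul1mx mulmx1.
by rewrite exprSr -[_ * _]/(_ *m _) -mulmxA endo_mor expr0n mulmx0 mulmx0.
Qed.

Lemma mor_fun_linear : linear mor_fun.
Proof.
move=> p u v; rewrite /mor_fun [p *: u]endmod_scaleE [_ *: (_ : Nbeta)]endmod_scaleE.
by rewrite mulmxA poly_mx_mor -mulmxA -mulmxDr.
Qed.

HB.instance Definition _ :=
  GRing.isLinear.Build {poly K} Nalpha Nbeta _ mor_fun mor_fun_linear.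

(* The image of mor_fun, i.e. the column space of the matrix; see im_morP.    *)
Definition im_mor : {pred Nbeta} :=
  fun v => ((v : 'cV[K]_b)^T <= (mor X)^T)%MS.

Lemma im_morP (v : Nbeta) : reflect (exists u, v = mor_fun u) (v \in im_mor).
Proof.
apply: (iffP submxP) => [[D vD]|[u ->]]; last by exists u^T; rewrite trmx_mul.
by exists D^T; rewrite -[LHS]trmxK vD trmx_mul trmxK.
Qed.

Lemma im_mor_submod : submod_closed im_mor.
Proof.
split=> [|p _ _ /im_morP[u ->] /im_morP[v ->]]; apply/im_morP.
  by exists 0; rewrite raddf0.
by exists (p *: u + v); rewrite linearP.
Qed.

HB.instance Definition _ :=
  GRing.isSubmodClosed.Build {poly K} Nbeta im_mor im_mor_submod.

Definition coker := qmod im_mor.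

End Cokernel.

Definition assoc_triple (K : fieldType) (a b : nat) (X : aVb K a b)
    (alpha beta gamma : seq nat) : Prop :=
  [/\ [&& is_partition alpha, is_partition beta & is_partition gamma],
      lmod_iso (Nmod K alpha) (endmod (0 : 'M[K]_a)),
      lmod_iso (Nmod K beta) (endmod (endo X))
    & lmod_iso (Nmod K gamma) (coker X)].

Section Dimension.

(* The dimension of a subset S of a space T given by its closed sets: the     *)
(* supremum of the lengths n of the chains Z_0 < ... < Z_n of irreducible     *)
(* closed subsets of S for the induced topology.                              *)
Variables (T : Type) (closed : (T -> Prop) -> Prop) (S : T -> Prop).

Definition incl (A B : T -> Prop) : Prop := forall x, A x -> B x.

Definition closed_in (Z : T -> Prop) : Prop :=
  exists2 C, closed C & forall x, Z x <-> S x /\ C x.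

Definition irreducible_in (Z : T -> Prop) : Prop :=
  (exists x, Z x) /\
  forall C D, closed_in C -> closed_in D -> incl Z (fun x => C x \/ D x) ->
    incl Z C \/ incl Z D.

Definition irr_chain (n : nat) (Z : nat -> T -> Prop) : Prop :=
  (forall i, (i <= n)%N -> closed_in (Z i) /\ irreducible_in (Z i)) /\
  (forall i, (i < n)%N -> incl (Z i) (Z i.+1) /\ ~ incl (Z i.+1) (Z i)).

Definition krull_dim (d : nat) : Prop :=
  (exists Z, irr_chain d Z) /\ forall n Z, irr_chain n Z -> (n <= d)%N.

End Dimension.

Section Zariski.

Variables (K : fieldType) (a b : nat).

Definition ambient : Type := 'M[K]_(b, a) * 'M[K]_b.

Definition coords (Y : ambient) (i : 'I_(b * a + b * b)) : K :=
  row_mx (mxvec Y.1) (mxvec Y.2) 0 i.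

Definition zariski_closed (Z : ambient -> Prop) : Prop :=
  exists I : {mpoly K[b * a + b * b]} -> Prop,
    forall Y, Z Y <-> forall p, I p -> p.@[coords Y] = 0.

Definition gl_act (g : 'M[K]_a) (h : 'M[K]_b) (Y : ambient) : ambient :=
  (h *m Y.1 *m invmx g, h *m Y.2 *m invmx h).

Definition gl_orbit (X : aVb K a b) (Y : ambient) : Prop :=
  exists g h, [/\ g \in unitmx, h \in unitmx & Y = gl_act g h (mor X, endo X)].

End Zariski.

(* Main.v *)
Require Import Defs.
From HB Require Import structures.
From mathcomp Require Import all_boot all_order all_algebra.
From mathcomp Require Import mpoly.
From mathcomp Require Import zify.
From Stdlib Require Import Classical.

Set Implicit Arguments.
Unset Strict Implicit.
Unset Printing Implicit Defensive.

Import GRing.Theory.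
Local Open Scope ring_scope.

(** Write V for the space of pairs (g, h) of square matrices of sizes a and b,
    and E for its linear subspace of endomorphisms of X, that is, of pairs
    with h f = f g and h phi = phi h.  The stabilizer of X is the set of
    invertible elements of E, which is open in E, so the orbit should have
    dimension dim V - dim E; it remains to compute dim E.

    Dimension of the orbit.  Let W be a complement of E in V.  The affine slice
    1 + W has dimension d = dim V - dim E and meets almost every coset t E^x
    (slice_meets_cosets, by Cramer's rule), so polynomial functions on the orbit
    are determined by their restriction to the image of the slice.  There they
    are quotients of polynomials in d variables, hence any d + 1 of them satisfy
    an algebraic relation (alg_dep, by counting monomials; orbit_relation).  A
    chain of irreducible closed sets of length d + 1 provides functions p_0, ...,
    p_d with p_i zero on Z_i but not on Z_(i+1), and these cannot satisfy a
    relation: on Z_(d+1) the smallest power of p_d can be cancelled, restriction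
    to Z_d then kills the other powers, and so on down to Z_0 (peel_chain).
    Conversely, the coordinates of the slice are rational functions on the orbit
    (slice_coord): a point t of the slice solves a linear system determined by
    the point t X, and this system has a unique solution near t = 1.  Hence the
    closures of the images of the coordinate flag of 1 + W form a strictly
    increasing chain of length d (stratum_chain).

    Dimension of E.  Since f is injective, E is isomorphic to the algebra of the
    h that commute with phi and preserve the image of f, a subspace U of the
    kernel of phi.  Restriction to the image of phi maps this algebra onto the
    one attached to (im phi, U cap im phi) (restr_surj), and its kernel consists
    of maps from the cokernel of phi to the kernel of phi that send the class
    of U into U.  With s_i = rk phi^i - rk phi^(i+1) and
    u_i = dim (U cap im phi^i), induction yields (dim_stab)
      dim E = sum_i (s_i^2 - (u_i - u_(i+1)) (s_i - u_i)).

    Partitions.  The numbers dim T^i N determine the column lengths of the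
    partition of a module N, so s_i is the i-th column length of beta and
    s_i - (u_i - u_(i+1)) that of gamma, while alpha is a single column of
    length a = u_0.  Since n(lambda) is the sum of the binomials C(c, 2) over the
    column lengths c (npart_columns), the formula for dim E becomes
    n(alpha) + n(beta) + n(gamma) + b after telescoping the binomials C(u_i, 2)
    (stab_dim_identity). *)

(** * Polynomial functions *)

Section PolyFun.
Variable K : fieldType.

Definition polyfun n (F : 'rV[K]_n -> K) : Prop :=
  exists p : {mpoly K[n]}, forall v, F v = p.@[v 0].

Section Closure.
Variable n : nat.
Implicit Types F G : 'rV[K]_n -> K.

Lemma polyfun_ext F G : F =1 G -> polyfun F -> polyfun G.
Proof. by move=> eqFG [p Fp]; exists p => v; rewrite -eqFG. Qed.

Lemma polyfun_const c : polyfun (fun _ : 'rV[K]_n => c).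
Proof. by exists c%:MP => v; rewrite mevalC. Qed.

Lemma polyfun_coord i : polyfun (fun v : 'rV[K]_n => v 0 i).
Proof. by exists 'X_i => v; rewrite mevalXU. Qed.

Lemma polyfunD F G : polyfun F -> polyfun G -> polyfun (fun v => F v + G v).
Proof. by move=> [p Fp] [q Gq]; exists (p + q) => v; rewrite mevalD Fp Gq. Qed.

Lemma polyfunM F G : polyfun F -> polyfun G -> polyfun (fun v => F v * G v).
Proof. by move=> [p Fp] [q Gq]; exists (p * q) => v; rewrite mevalM Fp Gq. Qed.

Lemma polyfun_sum I (r : seq I) (P : pred I) (F : I -> 'rV[K]_n -> K) :
  (forall i, polyfun (F i)) -> polyfun (fun v => \sum_(i <- r | P i) F i v).
Proof.
move=> polyF; elim: r => [|i r IHr].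
  by apply: polyfun_ext (polyfun_const 0) => v; rewrite big_nil.
case Pi: (P i); last by apply: polyfun_ext IHr => v; rewrite big_cons Pi.
by apply: polyfun_ext (polyfunD (polyF i) IHr) => v; rewrite big_cons Pi.
Qed.

Lemma polyfun_prod I (r : seq I) (P : pred I) (F : I -> 'rV[K]_n -> K) :
  (forall i, polyfun (F i)) -> polyfun (fun v => \prod_(i <- r | P i) F i v).
Proof.
move=> polyF; elim: r => [|i r IHr].
  by apply: polyfun_ext (polyfun_const 1) => v; rewrite big_nil.
case Pi: (P i); last by apply: polyfun_ext IHr => v; rewrite big_cons Pi.
by apply: polyfun_ext (polyfunM (polyF i) IHr) => v; rewrite big_cons Pi.
Qed.

Lemma polyfunX F k : polyfun F -> polyfun (fun v => F v ^+ k).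
Proof.
move=> polyF; elim: k => [|k IHk]; first exact: polyfun_const.
by apply: polyfun_ext (polyfunM polyF IHk) => v; rewrite exprS.
Qed.

Lemma polyfun_linear F :
  (forall c u v, F (c *: u + v) = c * F u + F v) -> polyfun F.
Proof.
move=> linF.
have F0 : F 0 = 0.
  have := linF 1 0 0; rewrite scaler0 add0r mul1r => /eqP.
  by rewrite -subr_eq subrr eq_sym => /eqP.
have E v : F v = \sum_i v 0 i * F (delta_mx 0 i).
  rewrite {1}[v]row_sum_delta; elim: (index_enum _) => [|i r IHr].
    by rewrite !big_nil F0.
  by rewrite !big_cons linF IHr.
apply: polyfun_ext (fun v => esym (E v)) _; apply: polyfun_sum => i.
by apply: polyfunM; [apply: polyfun_coord | apply: polyfun_const].
Qed.

End Closure.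

Lemma polyfun_meval n m (p : {mpoly K[m]}) (y : 'rV[K]_n -> 'I_m -> K) :
  (forall i, polyfun (fun v => y v i)) -> polyfun (fun v => p.@[y v]).
Proof.
move=> polyy; apply: (@polyfun_ext _ (fun v =>
   \sum_(k <- msupp p) p@_k * \prod_i y v i ^+ k i)).
  by move=> v; rewrite mevalE.
apply: polyfun_sum => k; apply: polyfunM; first exact: polyfun_const.
by apply: polyfun_prod => i; apply: polyfunX.
Qed.

Lemma polyfun_comp n m (F : 'rV[K]_m -> K) (y : 'rV[K]_n -> 'rV[K]_m) :
  polyfun F -> (forall i, polyfun (fun v => y v 0 i)) ->
  polyfun (fun v => F (y v)).
Proof.
move=> [p Fp] polyy; apply: (@polyfun_ext _ (fun v => p.@[y v 0])).
  by move=> v; rewrite Fp.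
exact: polyfun_meval.
Qed.

(** Clearing denominators: multiplying the value of [p] at a point of the form
    y / D by a power of D that is at least the degree of [p] makes it polynomial. *)
Lemma polyfun_homog n m (p : {mpoly K[m]}) (D : 'rV[K]_n -> K)
    (y : 'rV[K]_n -> 'I_m -> K) :
  polyfun D -> (forall i, polyfun (fun v => y v i)) ->
  exists k F, polyfun F /\
    forall v, D v != 0 -> F v = D v ^+ k * p.@[fun i => (D v)^-1 * y v i].
Proof.
move=> polyD polyy; exists (msize p).
exists (fun v => \sum_(k <- msupp p)
   p@_k * D v ^+ (msize p - mdeg k) * \prod_i y v i ^+ k i); split.
  apply: polyfun_sum => k; apply: polyfunM.
    by apply: polyfunM; [apply: polyfun_const | apply: polyfunX].
  by apply: polyfun_prod => i; apply: polyfunX.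
move=> v Dv; rewrite mevalE mulr_sumr [LHS]big_seq [RHS]big_seq.
apply: eq_bigr => k kp; rewrite mulrCA -mulrA; congr (_ * _).
have lek : (mdeg k <= msize p)%N by apply/ltnW/msize_mdeg_lt.
under [in RHS]eq_bigr do rewrite exprMn.
rewrite big_split /= mulrA; congr (_ * _).
rewrite -[in RHS](subnK lek) exprD -mulrA -{1}[D v ^+ _]mulr1; congr (_ * _).
have -> : \prod_i (D v)^-1 ^+ k i = (D v)^-1 ^+ mdeg k.
  by rewrite mdegE expr_sum.
by rewrite -exprMn divff // expr1n.
Qed.

Section Matrices.
Variable n : nat.

Definition polymx p q (A : 'rV[K]_n -> 'M[K]_(p, q)) : Prop :=
  forall i j, polyfun (fun v => A v i j).

Lemma polymx_const p q (A : 'M[K]_(p, q)) : polymx (fun=> A).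
Proof. by move=> i j; apply: polyfun_const. Qed.

Lemma polymxM p q r (A : 'rV[K]_n -> 'M[K]_(p, q))
    (B : 'rV[K]_n -> 'M[K]_(q, r)) :
  polymx A -> polymx B -> polymx (fun v => A v *m B v).
Proof.
move=> polyA polyB i j; apply: (@polyfun_ext _ (fun v => \sum_k A v i k * B v k j)).
  by move=> v; rewrite mxE.
by apply: polyfun_sum => k; apply: polyfunM.
Qed.

Lemma polymxD p q (A B : 'rV[K]_n -> 'M[K]_(p, q)) :
  polymx A -> polymx B -> polymx (fun v => A v + B v).
Proof.
move=> polyA polyB i j; apply: (@polyfun_ext _ (fun v => A v i j + B v i j)).
  by move=> v; rewrite mxE.
exact: polyfunD.
Qed.

Lemma polymxZ p q (F : 'rV[K]_n -> K) (A : 'rV[K]_n -> 'M[K]_(p, q)) :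
  polyfun F -> polymx A -> polymx (fun v => F v *: A v).
Proof.
move=> polyF polyA i j; apply: (@polyfun_ext _ (fun v => F v * A v i j)).
  by move=> v; rewrite mxE.
exact: polyfunM.
Qed.

Lemma polyfun_det p (A : 'rV[K]_n -> 'M[K]_p) :
  polymx A -> polyfun (fun v => \det (A v)).
Proof.
move=> polyA; apply: polyfun_sum => s; apply: polyfunM; first exact: polyfun_const.
by apply: polyfun_prod => i.
Qed.

Lemma polymx_adj p (A : 'rV[K]_n -> 'M[K]_p) :
  polymx A -> polymx (fun v => \adj (A v)).
Proof.
move=> polyA i j.
apply: (@polyfun_ext _ (fun v => (-1) ^+ (j + i) * \det (row' j (col' i (A v))))).
  by move=> v; rewrite mxE.
apply: polyfunM; first exact: polyfun_const.
apply: polyfun_det => k l.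
by apply: polyfun_ext (polyA (lift j k) (lift i l)) => v; rewrite !mxE.
Qed.

End Matrices.
End PolyFun.

Section Density.
Variable K : closedFieldType.

(** A root of [p - 1] serves as the witness, unless [p] is constant. *)
Lemma poly_nonroot (p : {poly K}) : p != 0 -> exists x, p.[x] != 0.
Proof.
move=> p0; have [/size_poly1P[c c0 ->]|np1] := boolP (size p == 1).
  by exists 0; rewrite hornerC.
have : size (p - 1) != 1.
  have lt1p : (1 < size p)%N by rewrite ltn_neqAle eq_sym np1 lt0n size_poly_eq0.
  by rewrite size_polyDl // size_polyN size_poly1.
case/closed_rootP=> x /rootP; rewrite hornerD hornerN hornerC => /eqP.
by rewrite subr_eq0 => /eqP px; exists x; rewrite px oner_eq0.
Qed.

(** Irreducibility of affine space is only used along lines, where it reduces to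
    the fact that a nonzero polynomial in one variable over an infinite field
    has a nonzero value. *)
Lemma polyfun_line n (F : 'rV[K]_n -> K) u v : polyfun F ->
  exists q : {poly K}, forall x, q.[x] = F (u + x *: v).
Proof.
move=> [p Fp]; exists (\sum_(k <- msupp p)
   p@_k *: \prod_i ((u 0 i)%:P + v 0 i *: 'X) ^+ k i) => x.
rewrite Fp mevalE horner_sum; apply: eq_bigr => k _.
rewrite hornerZ horner_prod; congr (_ * _); apply: eq_bigr => i _.
by rewrite horner_exp !hornerE !mxE mulrC.
Qed.

(** Affine space is irreducible: restrict [F] and [G] to the line through [u]
    and [v]. *)
Lemma polyfun_dense n (F G : 'rV[K]_n -> K) u v : polyfun F -> polyfun G ->
  F u != 0 -> G v != 0 -> exists w, F w != 0 /\ G w != 0.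
Proof.
move=> polyF polyG Fu Gv.
have [p Fp] := polyfun_line u (v - u) polyF.
have [q Gq] := polyfun_line u (v - u) polyG.
have p0 : p != 0.
  by apply: contraNneq Fu => p0; rewrite -[u]addr0 -(scale0r (v - u)) -Fp p0 horner0.
have q0 : q != 0.
  apply: contraNneq Gv => q0.
  by rewrite -[v](subrK u) addrC -[_ - _]scale1r -Gq q0 horner0.
have [x] := poly_nonroot (mulf_neq0 p0 q0).
rewrite hornerM mulf_eq0 negb_or Fp Gq => /andP[Fx Gx].
by exists (u + x *: (v - u)).
Qed.
End Density.

Section AlgDep.
Variable K : fieldType.

Lemma card_bmultinom d b : (#|{: 'X_{1..d < b}}| <= b ^ d)%N.
Proof.
rewrite -[X in (_ <= _ ^ X)%N]card_ord -[X in (_ <= X ^ _)%N]card_ord -card_ffun.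
have lt_b (m : 'X_{1..d < b}) (i : 'I_d) : (m i < b)%N.
  by rewrite (leq_ltn_trans _ (bmdeg m)) // mdegE (bigD1 i) //= leq_addr.
pose f (m : 'X_{1..d < b}) := [ffun i => Ordinal (lt_b m i)].
apply: (@leq_card _ _ f) => m1 m2 /ffunP eqf; apply/eqP; rewrite bmeqP.
by apply/eqP/mnmP => i; have := congr1 val (eqf i); rewrite !ffunE.
Qed.

Lemma msizeM_leS d (p q : {mpoly K[d]}) s t :
  (msize p <= s.+1 -> msize q <= t.+1 -> msize (p * q) <= (s + t).+1)%N.
Proof.
have [->|p0] := eqVneq p 0; first by rewrite mul0r msize0.
have [->|q0] := eqVneq q 0; first by rewrite mulr0 msize0.
rewrite msizeM // => lep leq; rewrite -subn1 leq_subLR.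
by apply: leq_trans (leq_add lep leq) _; lia.
Qed.

Lemma msize_prod_le d (I : finType) (p : I -> {mpoly K[d]}) m :
  (forall i, msize (p i) <= m.+1)%N -> (msize (\prod_i p i) <= (#|I| * m).+1)%N.
Proof.
move=> lep; rewrite cardT enumT [index_enum _]unlock.
elim: (Finite.enum I) => [|i r IHr]; first by rewrite big_nil msize1.
by rewrite big_cons /= mulSn; apply: msizeM_leS.
Qed.

Lemma msize_exp_le d (p : {mpoly K[d]}) m k :
  (msize p <= m.+1 -> msize (p ^+ k) <= (k * m).+1)%N.
Proof.
move=> lep; have := @msize_prod_le d 'I_k (fun=> p) m (fun=> lep).
by rewrite prodr_const card_ord.
Qed.

(** Any [d.+1] rational functions P_i / R_i in [d] variables are algebraically
    dependent.  The relation is sought with exponents at most [n] and is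
    homogenized by the R_i.  There are (n+1)^(d+1) unknown coefficients, and at
    most b^d conditions, one for each monomial of degree below b, where b grows
    linearly with n; hence the conditions are fewer for large n. *)
Lemma alg_dep d (P R : 'I_d.+1 -> {mpoly K[d]}) :
  exists n (c : {ffun {ffun 'I_d.+1 -> 'I_n.+1} -> K}),
    c != 0 /\
    \sum_e c e *: (\prod_i (P i ^+ e i * R i ^+ (n - e i))) = 0.
Proof.
pose m := \max_i maxn (msize (P i)) (msize (R i)).
have leP i : (msize (P i) <= m.+1)%N.
  by apply/leqW/(leq_trans _ (leq_bigmax i))/leq_maxl.
have leR i : (msize (R i) <= m.+1)%N.
  by apply/leqW/(leq_trans _ (leq_bigmax i))/leq_maxr.
(* This [n] is large enough because the degrees are at most (d+1) n m, and
   ((d+1) n m + 1)^d <= ((n+1) ((d+1) m + 1))^d = (n+1)^d n < (n+1)^(d+1). *)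
pose n := ((d.+1 * m).+1 ^ d)%N; exists n.
pose mon (e : {ffun 'I_d.+1 -> 'I_n.+1}) :=
  \prod_i (P i ^+ e i * R i ^+ (n - e i)).
pose b := (d.+1 * (n * m)).+1.
have le_mon e : (msize (mon e) <= b)%N.
  rewrite /b -[X in (X * _)%N]card_ord; apply: msize_prod_le => i.
  have -> : (n * m = e i * m + (n - e i) * m)%N.
    by rewrite -mulnDl subnKC // -ltnS.
  by apply: msizeM_leS; apply: msize_exp_le.
pose A := \matrix_(i < #|{: {ffun 'I_d.+1 -> 'I_n.+1}}|, j < #|{: 'X_{1..d < b}}|)
   (mon (enum_val i))@_(enum_val j).
have : kermx A != 0.
  rewrite kermx_eq0 /row_free neq_ltn; apply/orP; left.
  apply: leq_ltn_trans (rank_leq_col _) _.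
  apply: leq_ltn_trans (card_bmultinom _ _) _.
  rewrite card_ffun !card_ord expnSr.
  apply: (@leq_ltn_trans ((n.+1 * (d.+1 * m).+1) ^ d)).
    have leX x y k : (x <= y)%N -> (x ^ k <= y ^ k)%N.
      by case: k => // k; rewrite leq_exp2r.
    by apply: leX; rewrite /b; lia.
  by rewrite expnMn ltn_pmul2l ?expn_gt0.
case/rowV0Pn=> u /sub_kermxP uA u0; exists [ffun e => u 0 (enum_rank e)]; split.
  apply: contraNneq u0 => c0; apply/eqP/rowP => i.
  by have := congr1 (fun c : {ffun _} => c (enum_val i)) c0; rewrite !ffunE enum_valK mxE.
apply/mpolyP => k; rewrite mcoeff0 raddf_sum /=.
have [lek|gek] := ltnP (mdeg k) b; last first.
  rewrite big1 // => e _; rewrite mcoeffZ.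
  have /memN_msupp_eq0-> : k \notin msupp (mon e); last by rewrite mulr0.
  by apply: msize_mdeg_ge; apply: leq_trans gek.
have := congr1 (fun u : 'rV_(_) => u 0 (enum_rank (BMultinom lek))) uA.
rewrite !mxE => uA0; rewrite -[RHS]uA0.
rewrite [LHS](reindex (fun i : 'I_#|{: {ffun 'I_d.+1 -> 'I_n.+1}}| => enum_val i)) /=.
  2: exact/onW_bij/enum_val_bij.
by apply: eq_bigr => i _; rewrite ffunE enum_valK mcoeffZ mxE enum_rankK.
Qed.

End AlgDep.

(** * The dimension of an orbit *)

Section Pack.
Variables (K : fieldType) (p q r s : nat).
Local Notation pair := ('M[K]_(p, q) * 'M[K]_(r, s))%type.

Definition pack (Y : pair) : 'rV[K]_(p * q + r * s) :=
  row_mx (mxvec Y.1) (mxvec Y.2).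
Definition unpack (y : 'rV[K]_(p * q + r * s)) : pair :=
  (vec_mx (lsubmx y), vec_mx (rsubmx y)).

Lemma packK : cancel pack unpack.
Proof. by case=> A B; rewrite /unpack row_mxKl row_mxKr !mxvecK. Qed.
Lemma unpackK : cancel unpack pack.
Proof. by move=> y; rewrite /pack !vec_mxK hsubmxK. Qed.

Lemma pack_linear : linear pack.
Proof.
by move=> c Y Z; rewrite /pack /= !linearP /= scale_row_mx add_row_mx.
Qed.
HB.instance Definition _ :=
  GRing.isLinear.Build K pair 'rV[K]_(p * q + r * s) _ pack pack_linear.

Lemma unpack_linear : linear unpack.
Proof. by move=> c y z; congr (_, _); rewrite !linearP. Qed.
HB.instance Definition _ :=
  GRing.isLinear.Build K 'rV[K]_(p * q + r * s) pair _ unpack unpack_linear.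

Lemma polymx_pack n (A : 'rV[K]_n -> 'M[K]_(p, q)) (B : 'rV[K]_n -> 'M[K]_(r, s)) :
  polymx A -> polymx B -> polymx (fun v => pack (A v, B v)).
Proof.
move=> polyA polyB i j; rewrite ord1; case: (split_ordP j) => k ->.
  case/mxvec_indexP: k => k l; apply: polyfun_ext (polyA k l) => v.
  by rewrite row_mxEl mxvecE.
case/mxvec_indexP: k => k l; apply: polyfun_ext (polyB k l) => v.
by rewrite row_mxEr mxvecE.
Qed.
End Pack.

Lemma polymx_linear (K : fieldType) n m p q (L : 'rV[K]_m -> 'M[K]_(p, q))
    (y : 'rV[K]_n -> 'rV[K]_m) :
  linear L -> polymx y -> polymx (fun v => L (y v)).
Proof.
move=> linL polyy i j.
apply: (@polyfun_comp _ _ _ (fun u => L u i j)) => //.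
by apply: polyfun_linear => c u v; rewrite linL !mxE.
Qed.

Lemma polymx_id (K : fieldType) n : polymx (fun v : 'rV[K]_n => v).
Proof. by move=> i j; rewrite ord1; apply: polyfun_coord. Qed.

Lemma polymx_unpack (K : fieldType) p q r s :
  polymx (fun v : 'rV[K]_(p * q + r * s) => (unpack v).1) /\
  polymx (fun v : 'rV[K]_(p * q + r * s) => (unpack v).2).
Proof.
split.
  apply: (polymx_linear (L := fun x => (unpack x).1)); last exact: polymx_id.
  by move=> c x y; rewrite unpack_linear.
apply: (polymx_linear (L := fun x => (unpack x).2)); last exact: polymx_id.
by move=> c x y; rewrite unpack_linear.
Qed.

Lemma mul_row_matrix (K : fieldType) m n (L : 'rV[K]_m -> 'rV[K]_n) y :
  linear L -> y *m (\matrix_i L (delta_mx 0 i)) = L y.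
Proof.
move=> linL.
have L0 : L 0 = 0.
  have := linL 1 0 0; rewrite scaler0 add0r scale1r => /eqP.
  by rewrite -subr_eq subrr eq_sym => /eqP.
rewrite mulmx_sum_row [in RHS](row_sum_delta y).
elim: (index_enum _) => [|i r IHr]; first by rewrite !big_nil.
by rewrite !big_cons linL IHr rowK.
Qed.

Section Orbit.
Variables (K : closedFieldType) (a b : nat) (f : 'M[K]_(b, a)) (phi : 'M[K]_b).

Local Notation V := ('M[K]_a * 'M[K]_b)%type.
Local Notation T := ('M[K]_(b, a) * 'M[K]_b)%type.
Implicit Types (s t : V) (Y : T).

(** The defect of [t] to be a morphism from (f, phi) to [Y]. *)
Definition intertwine Y t : T :=
  (t.2 *m f - Y.1 *m t.1, t.2 *m phi - Y.2 *m t.2).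

Lemma intertwine_linear Y : linear (intertwine Y).
Proof.
move=> c s t; rewrite /intertwine /=; congr (_, _);
by rewrite !mulmxDl !mulmxDr -!scalemxAl -!scalemxAr opprD addrACA -scalerBr.
Qed.
HB.instance Definition _ Y :=
  GRing.isLinear.Build K V T _ (intertwine Y) (intertwine_linear Y).

Definition endo_space : {vspace V} := lker (linfun (intertwine (f, phi))).

Lemma endo_spaceP t :
  reflect (t.2 *m f = f *m t.1 /\ t.2 *m phi = phi *m t.2) (t \in endo_space).
Proof.
rewrite memv_ker lfunE /= /intertwine.
apply: (iffP eqP) => [[/eqP + /eqP]|[-> ->]]; last by rewrite !subrr.
by rewrite !subr_eq0 => /eqP-> /eqP->.
Qed.

Definition mulV s t : V := (s.1 *m t.1, s.2 *m t.2).
Definition oneV : V := (1%:M, 1%:M).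
Definition detV t : K := \det t.1 * \det t.2.
Definition actV t : T := gl_act t.1 t.2 (f, phi).

Lemma detV_unit t : (detV t != 0) = (t.1 \in unitmx) && (t.2 \in unitmx).
Proof. by rewrite !unitmxE !unitfE mulf_eq0 negb_or. Qed.

Lemma detVM s t : detV (mulV s t) = detV s * detV t.
Proof. by rewrite /detV !det_mulmx mulrACA. Qed.

Lemma detV1 : detV oneV = 1.
Proof. by rewrite /detV !det1 mulr1. Qed.

Lemma mulV_linear s : linear (mulV s).
Proof. by move=> c t u; rewrite /mulV !mulmxDr -!scalemxAr. Qed.
HB.instance Definition _ s := GRing.isLinear.Build K V V _ (mulV s) (mulV_linear s).

Lemma mulV1 : left_id oneV mulV.
Proof. by case=> g h; rewrite /mulV !mul1mx. Qed.

Lemma oneV_endo : oneV \in endo_space.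
Proof. by apply/endo_spaceP; rewrite !mul1mx !mulmx1. Qed.

Lemma actV1 : actV oneV = (f, phi).
Proof. by rewrite /actV /gl_act !invmx1 !mulmx1 !mul1mx. Qed.

Lemma intertwine_act t : detV t != 0 -> intertwine (actV t) t = 0.
Proof.
rewrite detV_unit => /andP[t1 t2].
by rewrite /intertwine /actV /gl_act /= !mulmxKV // !subrr.
Qed.

Lemma invmxM n (A B : 'M[K]_n) : A \in unitmx -> B \in unitmx ->
  invmx (A *m B) = invmx B *m invmx A.
Proof.
move=> uA uB; have uAB : A *m B \in unitmx by rewrite unitmx_mul uA.
apply: (can_inj (mulKmx uAB)); rewrite mulmxV //.
by rewrite -mulmxA mulKVmx // mulmxV.
Qed.

Lemma actV_endo t s : detV t != 0 -> detV s != 0 -> s \in endo_space ->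
  actV (mulV t s) = actV t.
Proof.
rewrite !detV_unit => /andP[t1 t2] /andP[s1 s2] /endo_spaceP[sf sphi].
rewrite /actV /gl_act /= !invmxM //; congr (_, _).
  by rewrite -(mulmxA t.2) sf !mulmxA mulmxK.
by rewrite -(mulmxA t.2) sphi !mulmxA mulmxK.
Qed.

(** The numerator of t X, whose common denominator is [detV t]. *)
Definition act_num t : T :=
  (\det t.2 *: (t.2 *m f *m \adj t.1), \det t.1 *: (t.2 *m phi *m \adj t.2)).

Lemma coords_actV t : detV t != 0 ->
  coords (actV t) =1 (fun i => (detV t)^-1 * pack (act_num t) 0 i).
Proof.
move=> t0 i; have := t0; rewrite detV_unit => /andP[t1 t2].
have : \det t.1 != 0 /\ \det t.2 != 0.
  by apply/andP; rewrite -negb_or -mulf_eq0.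
case=> d1 d2.
suff -> : act_num t = detV t *: actV t.
  by rewrite linearZ /= [in RHS]mxE mulrA mulVf // mul1r.
rewrite /actV /gl_act /act_num /invmx t1 t2 /=; congr (_, _) => /=.
  by rewrite -scalemxAr scalerA /detV mulrAC divff // mul1r.
by rewrite -scalemxAr scalerA /detV mulfK.
Qed.

(** Expressing the inverses by adjugates makes t X the quotient of [act_num t],
    which is polynomial in t, by [detV t]; so [polyfun_homog] applies. *)
Lemma orbit_fun n (t : 'rV[K]_n -> V) (p : {mpoly K[b * a + b * b]}) :
  polymx (fun v => (t v).1) -> polymx (fun v => (t v).2) ->
  exists k F, polyfun F /\
    forall v, detV (t v) != 0 ->
      F v = detV (t v) ^+ k * p.@[coords (actV (t v))].
Proof.
move=> poly1 poly2.
have polyD : polyfun (fun v => detV (t v)).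
  by apply: polyfunM; apply: polyfun_det.
have polyN i : polyfun (fun v => pack (act_num (t v)) 0 i).
  apply: (@polymx_pack _ _ _ _ _ _ (fun v => (act_num (t v)).1)
            (fun v => (act_num (t v)).2)); apply: polymxZ;
  by [apply: polyfun_det | do ?[apply: polymxM => //];
      [apply: polymx_const | apply: polymx_adj]].
have [k [F [polyF FE]]] := polyfun_homog p polyD polyN.
exists k, F; split=> // v Dv; rewrite FE //; congr (_ * _).
by apply: meval_eq => i; rewrite coords_actV.
Qed.

Lemma orbitP (X : aVb K a b) Y : mor X = f -> endo X = phi ->
  gl_orbit X Y <-> exists2 t, detV t != 0 & Y = actV t.
Proof.
move=> Xf Xphi; rewrite /gl_orbit Xf Xphi; split=> [[g [h [ug uh ->]]]|[[g h]]].
  by exists (g, h); rewrite ?detV_unit ?ug.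
by rewrite detV_unit => /andP[ug uh] ->; exists g, h.
Qed.

Local Notation W := (endo_space^C)%VS.
Local Notation d := (\dim W).

Definition slice_dir (x : 'rV[K]_d) : V := \sum_i x 0 i *: (vbasis W)`_i.
Definition slice x : V := oneV + slice_dir x.

Lemma slice_dir_linear : linear slice_dir.
Proof.
move=> c x y; rewrite /slice_dir scaler_sumr -big_split /=.
by apply: eq_bigr => i _; rewrite !mxE scalerDl scalerA.
Qed.
HB.instance Definition _ :=
  GRing.isLinear.Build K 'rV[K]_d V _ slice_dir slice_dir_linear.

Lemma slice_dir_mem x : slice_dir x \in W.
Proof.
apply: memv_suml => i _; apply: memvZ; apply: vbasis_mem.
by apply: mem_nth; rewrite size_tuple.
Qed.

Lemma slice_dir_surj u : u \in W -> exists x, u = slice_dir x.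
Proof.
move=> uW; exists (\row_i coord (vbasis W) i u).
by rewrite {1}(coord_vbasis uW); apply: eq_bigr => i _; rewrite mxE.
Qed.

Lemma slice_dir_inj x : slice_dir x = 0 -> x = 0.
Proof.
move=> /(congr1 (coord (vbasis W) _)) x0; apply/rowP => i.
have := x0 i; rewrite coord_sum_free ?(basis_free (vbasisP _)) // => ->.
by rewrite linear0 mxE.
Qed.

Lemma polymx_slice : polymx (fun x => (slice x).1) /\ polymx (fun x => (slice x).2).
Proof.
split; apply: polymxD; try exact: polymx_const.
  apply: (polymx_linear (L := fun x => (slice_dir x).1)); last exact: polymx_id.
  by move=> c x y; rewrite slice_dir_linear.
apply: (polymx_linear (L := fun x => (slice_dir x).2)); last exact: polymx_id.
by move=> c x y; rewrite slice_dir_linear.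
Qed.

Lemma slice0 : slice 0 = oneV.
Proof. by rewrite /slice linear0 addr0. Qed.

(** For t = 1 the map (e, w) |-> t e + w from E x W to V is the identity of
    V, so for generic t it is invertible, and the solution of t e + w = 1 is
    rational in t by Cramer's rule; at t = 1 it is e = 1, so e is invertible for
    generic t, and then t e = 1 - w lies in the slice.  The function [F] is the
    product of the determinants that have to be nonzero. *)
Lemma slice_meets_cosets : exists F : 'rV[K]_(a * a + b * b) -> K,
  [/\ polyfun F, F (pack oneV) != 0 &
   forall t, F (pack t) != 0 ->
     exists s x, [/\ s \in endo_space, detV s != 0 & mulV t s = slice x]].
Proof.
pose pE := projv endo_space.
have pElin c u v : pE (c *: u + v) = c *: pE u + pE v by rewrite linearP.
pose L (t u : V) : V := mulV t (pE u) + (u - pE u).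
have linLt t : linear (L t).
  move=> c u v.
  rewrite /L pElin mulV_linear scalerDr scalerBr opprD.
  by rewrite [RHS]addrACA (addrACA (c *: u) v).
have linL t : linear (fun y => pack (L t (unpack y))).
  by move=> c y z; rewrite unpack_linear linLt pack_linear.
pose M x := \matrix_i pack (L (unpack x) (unpack (delta_mx 0 i))).
have ME x y : y *m M x = pack (L (unpack x) (unpack y)).
  exact: (mul_row_matrix _ (linL (unpack x))).
have polyM : polymx M.
  move=> i j; apply: polyfun_ext
    (_ : polyfun (fun x => pack (L (unpack x) (unpack (delta_mx 0 i))) 0 j)).
    by move=> x; rewrite [RHS]mxE.
  have [poly1 poly2] := @polymx_unpack K a a b b.
  apply: (@polymx_pack K a a b b _ (fun x => (L (unpack x) _).1)
            (fun x => (L (unpack x) _).2)); apply: polymxD;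
  try exact: polymx_const; apply: polymxM => //; exact: polymx_const.
have M1 : M (pack oneV) = 1%:M.
  apply/row_matrixP => i; rewrite rowE ME packK /L mulV1 addrC subrK unpackK.
  by rewrite row1.
pose y x := pack oneV *m \adj (M x).
pose s x := pE (unpack (y x)).
have polyy : polymx y.
  by apply: polymxM; [apply: polymx_const | apply: polymx_adj].
have polys : polymx (fun x => (s x).1) /\ polymx (fun x => (s x).2).
  split.
    apply: (polymx_linear (L := fun u => (pE (unpack u)).1)) => //.
    by move=> c u v; rewrite unpack_linear pElin.
  apply: (polymx_linear (L := fun u => (pE (unpack u)).2)) => //.
  by move=> c u v; rewrite unpack_linear pElin.
exists (fun x => \det (M x) * detV (s x)); split.
- apply: polyfunM; first exact: polyfun_det.
  by apply: polyfunM; apply: polyfun_det; case: polys.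
- rewrite M1 det1 mul1r /s /y M1 adj1 mulmx1 packK projv_id ?oneV_endo //.
  by rewrite detV1 oner_eq0.
move=> t; set x := pack t; rewrite mulf_eq0 negb_or => /andP[dM ds].
have E : mulV t (s x) + (unpack (y x) - s x) = \det (M x) *: oneV.
  apply: (can_inj (@packK K a a b b)).
  have -> : mulV t (s x) = mulV (unpack x) (s x) by rewrite packK.
  rewrite -/(L (unpack x) (unpack (y x))) -ME -mulmxA mul_adj_mx.
  by rewrite mul_mx_scalar linearZ.
have uW : - ((\det (M x))^-1 *: (unpack (y x) - s x)) \in W.
  by rewrite memvN memvZ // memv_projC.
have [z Ez] := slice_dir_surj uW.
exists ((\det (M x))^-1 *: s x), z; split.
- by rewrite memvZ // memv_proj.
- move: ds; rewrite !detV_unit /= => /andP[u1 u2].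
  by rewrite !unitmxZ ?unitfE ?invr_eq0 // u1.
rewrite /slice -Ez linearZ /= -[oneV](scalerK dM) -E scalerDr.
by rewrite addrK.
Qed.

(** If [H] did not vanish at some invertible t, then by density it would not
    vanish at some t whose coset meets the slice, and by invariance not at the
    point of the slice in that coset. *)
Lemma slice_dense (H : V -> K) :
  polyfun (fun x => H (unpack x)) ->
  (forall t s, detV t != 0 -> detV s != 0 -> s \in endo_space ->
     H t != 0 -> H (mulV t s) != 0) ->
  (forall x, detV (slice x) != 0 -> H (slice x) = 0) ->
  forall t, detV t != 0 -> H t = 0.
Proof.
move=> polyH invH H0 t Dt; apply/eqP; apply: contraT => Ht.
have [F [polyF F1 FP]] := slice_meets_cosets.
have [poly1 poly2] := @polymx_unpack K a a b b.
have polyG : polyfun (fun x => H (unpack x) * detV (unpack x)).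
  by apply: polyfunM => //; apply: polyfunM; apply: polyfun_det.
have Gt : H (unpack (pack t)) * detV (unpack (pack t)) != 0.
  by rewrite packK mulf_neq0.
have [x []] := polyfun_dense polyG polyF Gt F1.
rewrite mulf_eq0 negb_or -{3}[x]unpackK => /andP[Hx Dx] /FP[s [z [sE Ds Es]]].
have := invH _ _ Dx Ds sE Hx; rewrite Es H0 ?eqxx //.
by rewrite -Es detVM mulf_neq0.
Qed.

(** On the slice, which has dimension [d], the relation is the one of
    [alg_dep]; [slice_dense] carries it to the whole orbit. *)
Lemma orbit_relation (p : 'I_d.+1 -> {mpoly K[b * a + b * b]}) :
  exists n (c : {ffun {ffun 'I_d.+1 -> 'I_n.+1} -> K}),
    c != 0 /\ forall t, detV t != 0 ->
    \sum_e c e * \prod_i (p i).@[coords (actV t)] ^+ e i = 0.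
Proof.
have [poly1 poly2] := polymx_slice.
have /fin_all_exists[k /fin_all_exists[F FP]] i := orbit_fun (p i) poly1 poly2.
have /fin_all_exists[P PP] i := (FP i).1.
have [R RP] : polyfun (fun x => detV (slice x)).
  by apply: polyfunM; apply: polyfun_det.
have [n [c [c0 cP]]] := alg_dep P (fun i => R ^+ k i).
exists n, c; split=> //.
pose q : {mpoly K[b * a + b * b]} := \sum_e c e *: \prod_i p i ^+ e i.
have qE v : q.@[v] = \sum_e c e * \prod_i (p i).@[v] ^+ e i.
  rewrite raddf_sum /=; apply: eq_bigr => e _; rewrite mevalZ rmorph_prod.
  by congr (_ * _); apply: eq_bigr => i _; rewrite rmorphXn.
have [poly1' poly2'] := @polymx_unpack K a a b b.
have [m [G [polyG GP]]] := orbit_fun q poly1' poly2'.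
suff G0 t : detV t != 0 -> G (pack t) = 0.
  move=> t Dt; rewrite -qE; have := GP (pack t); rewrite packK G0 // => /(_ Dt).
  by move/esym/eqP; rewrite mulf_eq0 expf_eq0 (negPf Dt) andbF => /eqP.
have Gq t' : detV t' != 0 -> (G (pack t') != 0) = (q.@[coords (actV t')] != 0).
  by move=> Dt'; rewrite GP packK // mulf_eq0 expf_eq0 (negPf Dt') andbF.
apply: (@slice_dense (fun t => G (pack t))).
- by apply: polyfun_ext polyG => x; rewrite unpackK.
- move=> t' s Dt' Ds sE; have Dts : detV (mulV t' s) != 0.
    by rewrite detVM mulf_neq0.
  by rewrite !Gq // actV_endo.
move=> x Dx; apply/eqP; rewrite -[_ == _]negbK Gq // negbK qE.
have Dn : \prod_(i < d.+1) (detV (slice x) ^+ k i) ^+ n != 0.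
  by apply/prodf_neq0 => i _; rewrite !expf_neq0.
rewrite -(mulrI_eq0 _ (mulfI Dn)) mulr_sumr.
have := congr1 (meval (x 0)) cP; rewrite meval0 raddf_sum /= => c_rel.
apply/eqP; rewrite -[RHS]c_rel; apply: eq_bigr => e _; rewrite mevalZ mulrCA; congr (_ * _).
rewrite rmorph_prod -big_split /=; apply: eq_bigr => i _.
rewrite rmorphM !rmorphXn /= -RP -PP (FP i).2 //.
move: (detV _ ^+ _) => D; rewrite exprMn mulrAC -exprD.
by rewrite subnKC // -ltnS.
Qed.

(** A point t = 1 + sum_i x_i w_i of the slice is a morphism from X to Y = t X,
    which gives the linear system  intertwine Y 1 + x A(Y) = 0  for x, with
    coefficients polynomial in Y.  For Y = X its matrix is injective, since W
    meets E trivially.  Selecting independent columns by a right inverse C of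
    A(X) gives a square matrix B(Y) = A(Y) C with B(X) = 1, and Cramer's rule
    expresses x_i as the quotient of polynomials [p] and [r] = det B. *)
Lemma slice_coord (i : 'I_d) : exists p r : {mpoly K[b * a + b * b]},
  r.@[coords (f, phi)] != 0 /\
  forall x, detV (slice x) != 0 ->
    p.@[coords (actV (slice x))] = x 0 i * r.@[coords (actV (slice x))].
Proof.
pose A Y : 'M[K]_(d, b * a + b * b) :=
  \matrix_j pack (intertwine Y (slice_dir (delta_mx 0 j))).
have AE Y x : x *m A Y = pack (intertwine Y (slice_dir x)).
  apply: (mul_row_matrix (L := fun x => pack (intertwine Y (slice_dir x)))).
  by move=> c u v; rewrite slice_dir_linear intertwine_linear pack_linear.
have /row_freeP[C AC] : row_free (A (f, phi)).
  rewrite -kermx_eq0; apply/eqP/row_matrixP => j; rewrite row0.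
  have := row_sub j (kermx (A (f, phi))) => /sub_kermxP.
  set x := row j _; rewrite AE => x0; apply: slice_dir_inj; apply/eqP.
  rewrite -memv0 -(capv_compl endo_space) memv_cap slice_dir_mem andbT.
  by rewrite memv_ker lfunE /= -(inj_eq (can_inj (@packK _ _ _ _ _))) x0 linear0.
pose B Y := A Y *m C.
pose N Y := - pack (intertwine Y oneV) *m C *m \adj (B Y).
have [poly1 poly2] := @polymx_unpack K b a b b.
have polyT t : polymx (fun y => pack (intertwine (unpack y) t)).
  apply: (@polymx_pack K _ _ _ _ _ (fun y => (intertwine (unpack y) t).1)
            (fun y => (intertwine (unpack y) t).2)).
    apply: polymxD; first exact: polymx_const.
    move=> k l; have := polymxM poly1 (polymx_const _ (- t.1)) => /(_ k l).
    by apply: polyfun_ext => y; rewrite mulmxN.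
  apply: polymxD; first exact: polymx_const.
  move=> k l; have := polymxM poly2 (polymx_const _ (- t.2)) => /(_ k l).
  by apply: polyfun_ext => y; rewrite mulmxN.
have polyB : polymx (fun y => B (unpack y)).
  apply: polymxM; last exact: polymx_const.
  by move=> k l; apply: polyfun_ext (polyT _ 0 l) => y; rewrite [RHS]mxE.
have [p pP] : polyfun (fun y => N (unpack y) 0 i).
  apply: (polymxM _ (polymx_adj polyB)); apply: polymxM; last exact: polymx_const.
  move=> k l; apply: polyfun_ext (polyfunM (polyfun_const _ (-1)) (polyT oneV k l)) => y.
  by rewrite [RHS]mxE mulN1r.
have [r rP] := polyfun_det polyB.
have pE Y : p.@[coords Y] = N Y 0 i by rewrite -[RHS](congr1 (fun Y => N Y 0 i) (packK Y)) pP.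
have rE Y : r.@[coords Y] = \det (B Y) by rewrite -[in RHS](packK Y) rP.
exists p, r; split; first by rewrite rE /B AC det1 oner_eq0.
move=> x Dx; rewrite pE rE; set Y := actV _.
have : pack (intertwine Y oneV) + x *m A Y = 0.
  have YE : intertwine Y oneV + intertwine Y (slice_dir x) = intertwine Y (slice x).
    by rewrite -linearD.
  by rewrite AE -linearD YE intertwine_act // linear0.
move/eqP; rewrite addrC addr_eq0 => /eqP xA.
by rewrite /N -xA -(mulmxA x) -mulmxA mul_mx_adj mul_mx_scalar mxE mulrC.
Qed.

End Orbit.

Section KrullDim.
Variables (K : closedFieldType) (a b : nat) (X : aVb K a b).
Local Notation f := (mor X).
Local Notation phi := (endo X).
Local Notation O := (gl_orbit X).
Local Notation closedO := (closed_in (@zariski_closed K a b) O).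
Local Notation irrO := (irreducible_in (@zariski_closed K a b) O).
Local Notation mp := {mpoly K[b * a + b * b]}.
Local Notation W := ((endo_space f phi)^C)%VS.
Local Notation d := (\dim W).
Local Notation act := (actV f phi).
Implicit Types (p q : mp) (Z : ambient K a b -> Prop).

Lemma zero_set_closed p : closedO (fun Y => O Y /\ p.@[coords Y] = 0).
Proof.
exists (fun Y => p.@[coords Y] = 0) => //.
by exists (eq p) => Y; split=> [pY _ <-|/(_ p erefl)].
Qed.

Lemma irreducible_mul Z p q : (forall Y, Z Y -> O Y) -> irrO Z ->
  (forall Y, Z Y -> (p * q).@[coords Y] = 0) ->
  (forall Y, Z Y -> p.@[coords Y] = 0) \/ (forall Y, Z Y -> q.@[coords Y] = 0).
Proof.
move=> ZO [_ irrZ] pq0.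
have [Y ZY||] := irrZ _ _ (zero_set_closed p) (zero_set_closed q).
- have /eqP := pq0 Y ZY; rewrite mevalM mulf_eq0 => /orP[]/eqP; have := ZO Y ZY;
  by [left | right].
- by move=> Zp; left => Y /Zp[].
by move=> Zq; right => Y /Zq[].
Qed.

Lemma irreducible_exp Z p k : (forall Y, Z Y -> O Y) -> irrO Z ->
  (forall Y, Z Y -> (p ^+ k).@[coords Y] = 0) ->
  forall Y, Z Y -> p.@[coords Y] = 0.
Proof.
move=> ZO irrZ; elim: k => [|k IHk]; last first.
  by rewrite exprS => /(irreducible_mul ZO irrZ)[].
by move=> p0 Y /p0/eqP; rewrite meval1 oner_eq0.
Qed.

(** The equations of a closed set form an arbitrary set of polynomials; one that
    does not vanish at [Y] is found by contradiction. *)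
Lemma closed_separation Z Y : closedO Z -> O Y -> ~ Z Y ->
  exists p, p.@[coords Y] != 0 /\ forall Y', Z Y' -> p.@[coords Y'] = 0.
Proof.
move=> [C [I CI] ZC] OY nZY.
have [p np] : exists p, ~ (I p -> p.@[coords Y] = 0).
  by apply: not_all_ex_not => Ip; apply: nZY; apply/ZC; split=> //; apply/CI.
have [Ip /eqP pY] := imply_to_and _ _ np.
by exists p; split=> // Y' /ZC[_ /CI]; apply.
Qed.

(** The relation is peeled off one function at a time.  The invariant at stage
    [j] is a nonempty set [A] of exponents with nonzero coefficients that agree
    from position [j] on and give a relation between the p_i with i < j on Z_j.
    To pass from j+1 to j, let m be the smallest j-th exponent in [A].  As Z_(j+1)
    is irreducible and p_j does not vanish on it, the relation can be divided by
    the m-th power of p_j; on Z_j, where p_j vanishes, only the exponents with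
    j-th entry m survive.  At stage 0 a single coefficient is left, and it
    vanishes at a point of Z_0. *)
Lemma peel_chain m n (Z : nat -> ambient K a b -> Prop) (p : 'I_m -> mp)
    (c : {ffun 'I_m -> 'I_n.+1} -> K) :
  (forall i Y, (i <= m)%N -> Z i Y -> O Y) ->
  (forall i, (i <= m)%N -> irrO (Z i)) ->
  (forall i, (i < m)%N -> incl (Z i) (Z i.+1)) ->
  (forall i : 'I_m, forall Y, Z i Y -> (p i).@[coords Y] = 0) ->
  (forall i : 'I_m, exists2 Y, Z i.+1 Y & (p i).@[coords Y] != 0) ->
  (forall Y, Z m Y -> \sum_e c e * \prod_i (p i).@[coords Y] ^+ e i = 0) ->
  forall e, c e = 0.
Proof.
move=> ZO irrZ incZ p0 pn0 rel e0; apply/eqP; apply: contraT => c0.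
suff /(_ 0 isT)[A [A0 cA eqA relA]] j : (j <= m)%N ->
    exists A : {set {ffun 'I_m -> 'I_n.+1}}, [/\ A != set0,
      forall e, e \in A -> c e != 0,
      forall e e' (i : 'I_m), e \in A -> e' \in A -> (j <= i)%N -> e i = e' i &
      forall Y, Z j Y ->
        \sum_(e in A) c e * \prod_(i < m | (i < j)%N) (p i).@[coords Y] ^+ e i = 0].
  have [e eA] := set0Pn _ A0; have [Y ZY] := (irrZ 0 isT).1.
  have {}eqA : A = [set e].
    apply/setP => e'; rewrite inE; apply/idP/eqP => [e'A|->//].
    by apply/ffunP => i; apply: eqA.
  have := relA Y ZY; rewrite eqA big_set1 big_pred0 // mulr1.
  by move/eqP; rewrite (negPf (cA e eA)).
move=> lejm; rewrite -(subKn lejm); elim: (m - j)%N (leq_subr j m) => [|k IHk] lek.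
  exists [set e | c e != 0]; split.
  - by apply/set0Pn; exists e0; rewrite inE.
  - by move=> e; rewrite inE.
  - by move=> e e' i _ _; rewrite subn0 leqNgt ltn_ord.
  rewrite subn0 => Y /rel; rewrite (bigID (fun e => c e != 0)) /=.
  rewrite [X in _ + X]big1 ?addr0; last by move=> e; rewrite negbK => /eqP->; rewrite mul0r.
  move=> rel'; rewrite -[RHS]rel'; apply: eq_big => [e|e _]; first by rewrite inE.
  by congr (_ * _); apply: eq_bigl => i; rewrite ltn_ord.
have [A [A0 cA eqA relA]] := IHk (ltnW lek).
have ltim : (m - k.+1 < m)%N by lia.
have Ei : (m - k)%N = (m - k.+1).+1 by lia.
rewrite {}Ei in eqA relA; set j' := (m - k.+1)%N in ltim eqA relA *.
pose i := Ordinal ltim.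
have [e1 e1A] := set0Pn _ A0.
case: (@arg_minnP _ e1 (mem A) (fun e => e i : nat) e1A) => e2 e2A mine2.
exists [set e in A | e i == e2 i]; split.
- by apply/set0Pn; exists e2; rewrite inE [_ \in A]e2A eqxx.
- by move=> e; rewrite inE => /andP[/cA].
- move=> e e' i'; rewrite !inE => /andP[eA /eqP ei] /andP[e'A /eqP e'i].
  rewrite leq_eqVlt => /orP[/eqP ii'|/eqA]; last exact.
  by have -> : i' = i; [apply: val_inj | rewrite ei].
pose q : mp := \sum_(e in A) c e *: (p i ^+ (e i - e2 i) *
                  \prod_(i' < m | (i' < j')%N) p i' ^+ e i').
have qE Y : q.@[coords Y] = \sum_(e in A) c e * ((p i).@[coords Y] ^+ (e i - e2 i) *
    \prod_(i' < m | (i' < j')%N) (p i').@[coords Y] ^+ e i').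
  rewrite raddf_sum /=; apply: eq_bigr => e _; rewrite mevalZ mevalM rmorphXn rmorph_prod.
  by congr (_ * (_ * _)); apply: eq_bigr => i' _; rewrite rmorphXn.
have lej' : (j'.+1 <= m)%N by [].
have [Y ZY|pk|q0] := @irreducible_mul (Z j'.+1) (p i ^+ e2 i) q
    (fun Y => @ZO _ Y lej') (irrZ _ lej').
- rewrite mevalM qE rmorphXn -[RHS](relA Y ZY) mulr_sumr; apply: eq_bigr => e eA.
  rewrite mulrCA; congr (_ * _); rewrite mulrA -exprD subnKC; last exact: mine2.
  rewrite [RHS](bigD1 i) //=; congr (_ * _); apply: eq_bigl => i'.
  by rewrite ltnS -(inj_eq val_inj) /= [in RHS]leq_eqVlt; case: ltngtP.
- have [Y ZY] := pn0 i.
  by rewrite (irreducible_exp (fun Y => @ZO _ Y lej') (irrZ _ lej') pk ZY) eqxx.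
move=> Y ZY; have := q0 Y (incZ _ lej' _ ZY); rewrite qE.
rewrite (bigID (fun e : {ffun 'I_m -> 'I_n.+1} => e i == e2 i)) /=.
rewrite [X in _ + X]big1 ?addr0; last first.
  move=> e /andP[eA nei]; rewrite p0 // expr0n.
  have := mine2 e eA; rewrite leq_eqVlt eq_sym (inj_eq val_inj) (negPf nei) /=.
  by move=> lte; rewrite subn_eq0 leqNgt lte mul0r mulr0.
move=> rel'; rewrite -[RHS]rel'; apply: eq_big => [e|e]; first by rewrite inE.
by rewrite inE => /andP[_ /eqP->]; rewrite subnn expr0 mul1r.
Qed.

Lemma chain_length_le n (Z : nat -> ambient K a b -> Prop) :
  irr_chain (@zariski_closed K a b) O n Z -> (n <= d)%N.
Proof.
move=> [irrZ strictZ]; rewrite leqNgt; apply/negP => ltdn.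
have ZO i Y : (i <= d.+1)%N -> Z i Y -> O Y.
  by move=> lei; have [[C _ ZC] _] := irrZ i (leq_trans lei ltdn) => /ZC[].
have sep (i : 'I_d.+1) : exists p, (exists2 Y, Z i.+1 Y & p.@[coords Y] != 0) /\
    forall Y, Z i Y -> p.@[coords Y] = 0.
  have ltin : (i < n)%N by apply: leq_trans (ltn_ord i) ltdn.
  have [_ ninc] := strictZ i ltin.
  have [Y nY] : exists Y, ~ (Z i.+1 Y -> Z i Y) by exact: not_all_ex_not.
  have [ZY nZY] := imply_to_and _ _ nY.
  have [p [pY p0]] := closed_separation (irrZ i (ltnW ltin)).1 (ZO i.+1 Y (ltn_ord i) ZY) nZY.
  by exists p; split=> //; exists Y.
have /fin_all_exists[p pP] := sep.
have [k [c [c0 rel]]] := orbit_relation p.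
case/eqP: c0; apply/ffunP => e; rewrite ffunE.
apply: (@peel_chain d.+1 k Z p c) => //.
- by move=> i lei; apply: (irrZ i (leq_trans lei ltdn)).2.
- by move=> i lti; apply: (strictZ i (leq_trans lti ltdn)).1.
- by move=> i; apply: (pP i).2.
- by move=> i; apply: (pP i).1.
move=> Y ZY; have [t Dt ->] := (orbitP Y erefl erefl).1 (ZO _ _ (leqnn _) ZY).
exact: rel.
Qed.

Definition trunc i (x : 'rV[K]_d) : 'rV[K]_d := \row_j (if (j < i)%N then x 0 j else 0).

Lemma polymx_trunc i : polymx (trunc i).
Proof.
apply: (polymx_linear (L := trunc i)); last exact: polymx_id.
move=> c x y; apply/rowP => j; rewrite !mxE.
by case: ifP => _ //; rewrite mulr0 addr0.
Qed.

Lemma trunc_trunc i j x : (i <= j)%N -> trunc j (trunc i x) = trunc i x.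
Proof.
move=> leij; apply/rowP => k; rewrite !mxE; case: ifP => // ; case: ifP => //.
by move=> ltki; rewrite (leq_trans ltki leij).
Qed.

(** The closure in the orbit of the image of the part of the slice spanned by
    the first [i] coordinate directions. *)
Definition stratum i (Y : ambient K a b) : Prop :=
  O Y /\ forall p,
    (forall x, detV (slice (trunc i x)) != 0 ->
       p.@[coords (act (slice (trunc i x)))] = 0) ->
    p.@[coords Y] = 0.

Lemma stratum_slice i x : detV (slice (trunc i x)) != 0 ->
  stratum i (act (slice (trunc i x))).
Proof.
move=> Dx; split; last by move=> p; apply.
by apply/(orbitP _ erefl erefl); exists (slice (trunc i x)).
Qed.

Lemma trunc0 i : trunc i 0 = 0.
Proof. by apply/rowP => j; rewrite !mxE; case: ifP. Qed.

Lemma detV_slice0 i : detV (slice (trunc i 0)) != 0.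
Proof. by rewrite trunc0 slice0 detV1 oner_eq0. Qed.

Lemma polymx_slice_trunc i : polymx (fun x => (slice (trunc i x)).1) /\
  polymx (fun x => (slice (trunc i x)).2).
Proof.
have [poly1 poly2] := polymx_slice f phi.
by split=> k l; [apply: polyfun_comp (poly1 k l) _ | apply: polyfun_comp (poly2 k l) _];
  apply: polymx_trunc.
Qed.

(** The image of a coordinate subspace of the slice is irreducible; after
    clearing denominators this is [polyfun_dense]. *)
Lemma slice_trunc_dense i p q x y :
  detV (slice (trunc i x)) != 0 -> detV (slice (trunc i y)) != 0 ->
  p.@[coords (act (slice (trunc i x)))] != 0 ->
  q.@[coords (act (slice (trunc i y)))] != 0 ->
  exists z, [/\ detV (slice (trunc i z)) != 0,
    p.@[coords (act (slice (trunc i z)))] != 0 &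
    q.@[coords (act (slice (trunc i z)))] != 0].
Proof.
move=> Dx Dy px qy; have [poly1 poly2] := polymx_slice_trunc i.
have [k [F [polyF FE]]] := orbit_fun f phi p poly1 poly2.
have [l [G [polyG GE]]] := orbit_fun f phi q poly1 poly2.
have polyD : polyfun (fun x => detV (slice (trunc i x))).
  by apply: polyfunM; apply: polyfun_det.
have Fx : F x * detV (slice (trunc i x)) != 0.
  by rewrite FE //; exact: (mulf_neq0 (mulf_neq0 (expf_neq0 k Dx) px) Dx).
have Gy : G y != 0 by rewrite GE //; exact: (mulf_neq0 (expf_neq0 l Dy) qy).
have [z []] := polyfun_dense (polyfunM polyF polyD) polyG Fx Gy.
rewrite mulf_eq0 negb_or => /andP[Fz Dz]; rewrite FE // GE // in Fz *.
move: Fz; rewrite !mulf_eq0 !negb_or => /andP[_ pz] /andP[_ qz].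
by exists z.
Qed.

Lemma stratum_closed i : closedO (stratum i).
Proof.
exists (fun Y => forall p, (forall x, detV (slice (trunc i x)) != 0 ->
       p.@[coords (act (slice (trunc i x)))] = 0) -> p.@[coords Y] = 0) => //.
by eexists => Y; split; apply.
Qed.

Lemma stratum_irreducible i : irrO (stratum i).
Proof.
split; first by exists (act (slice (trunc i 0))); apply/stratum_slice/detV_slice0.
have sep C : closedO C -> ~ incl (stratum i) C -> exists p x,
    [/\ detV (slice (trunc i x)) != 0,
        p.@[coords (act (slice (trunc i x)))] != 0 &
        forall Y, C Y -> p.@[coords Y] = 0].
  move=> clC nC.
  have [x nx] : exists x, ~ (detV (slice (trunc i x)) != 0 ->
      C (act (slice (trunc i x)))).
    apply: not_all_ex_not => inC; apply: nC => Y [OY YP].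
    apply: NNPP => nCY; have [p [pY pC]] := closed_separation clC OY nCY.
    by case/eqP: pY; apply: YP => x /inC/pC.
  have [Dx nCx] := imply_to_and _ _ nx.
  have [p [px pC]] := closed_separation clC (stratum_slice Dx).1 nCx.
  by exists p, x.
move=> C D clC clD inc; apply: NNPP => /not_or_and[nC nD].
have [p [x [Dx px pC]]] := sep C clC nC.
have [q [y [Dy qy qD]]] := sep D clD nD.
have [z [Dz pz qz]] := slice_trunc_dense Dx Dy px qy.
case: (inc _ (stratum_slice Dz)) => [/pC/eqP|/qD/eqP]; first by rewrite (negPf pz).
by rewrite (negPf qz).
Qed.

(** Strictness: the numerator of the i-th coordinate of the slice vanishes on
    the i-th stratum but not on the next one. *)
Lemma stratum_chain : irr_chain (@zariski_closed K a b) O d stratum.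
Proof.
split=> i lti; first by split; [apply: stratum_closed | apply: stratum_irreducible].
split=> [Y [OY YP]|inc].
  split=> // p p0; apply: YP => x.
  by rewrite -(trunc_trunc x (leqnSn i)); apply: p0.
pose j := Ordinal lti; have [p [r [r0 pE]]] := slice_coord j.
have p0 Y : stratum i Y -> p.@[coords Y] = 0.
  by case=> _; apply=> x Dx; rewrite pE // mxE ltnn mul0r.
pose x : 'rV[K]_d := delta_mx 0 j.
have [poly1 poly2] := polymx_slice_trunc i.+1.
have [k [F [polyF FE]]] := orbit_fun f phi r poly1 poly2.
have polyD : polyfun (fun x => detV (slice (trunc i.+1 x))).
  by apply: polyfunM; apply: polyfun_det.
have F0 : F 0 * detV (slice (trunc i.+1 0)) != 0.
  have D0 := detV_slice0 i.+1; rewrite FE //.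
  apply: (mulf_neq0 (mulf_neq0 (expf_neq0 k D0) _) D0).
  by rewrite trunc0 slice0 actV1.
have x0 : x 0 j != 0 by rewrite mxE !eqxx oner_eq0.
have [z []] := polyfun_dense (polyfunM polyF polyD) (@polyfun_coord K _ j) F0 x0.
rewrite mulf_eq0 negb_or => /andP[Fz Dz] zj; rewrite FE // in Fz.
move: Fz; rewrite mulf_eq0 negb_or => /andP[_ rz].
have /eqP := p0 _ (inc _ (stratum_slice Dz)).
by rewrite pE // mxE ltnS leqnn mulf_eq0 (negPf zj) (negPf rz).
Qed.

Lemma krull_dim_orbit : krull_dim (@zariski_closed K a b) O d.
Proof.
split; first by exists stratum; apply: stratum_chain.
exact: chain_length_le.
Qed.

End KrullDim.

(** * The dimension of the endomorphism algebra *)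

Section Sandwich.
Variable K : fieldType.

Lemma rank_factorization m n (A : 'M[K]_(m, n)) :
  exists (P : 'M[K]_(m, \rank A)) (Q : 'M[K]_(\rank A, n))
         (P' : 'M[K]_(\rank A, m)) (Q' : 'M[K]_(n, \rank A)),
  [/\ P *m Q = A, P' *m P = 1%:M & Q *m Q' = 1%:M].
Proof.
have [P' P'K] := row_fullP (col_base_full A).
have [Q' Q'K] := row_freeP (row_base_free A).
by exists (col_base A), (row_base A), P', Q'; rewrite mulmx_base.
Qed.

Lemma left_kernel_base m n (A : 'M[K]_(m, n)) :
  exists (D : 'M[K]_(m - \rank A, m)) (D' : 'M[K]_(m, m - \rank A)),
  [/\ D *m D' = 1%:M, D *m A = 0 &
   forall k (x : 'M[K]_(k, m)), x *m A = 0 -> x *m D' *m D = x].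
Proof.
rewrite -mxrank_ker.
have [P [Q [P' [Q' [PQ P'P QQ']]]]] := rank_factorization (kermx A).
have QE : P' *m kermx A = Q.
  by have /(congr1 (mulmx P')) := PQ; rewrite mulmxA P'P mul1mx.
exists Q, Q'; split=> //; first by rewrite -QE -mulmxA mulmx_ker mulmx0.
move=> k x /sub_kermxP/submxP[y ->].
have -> : y *m kermx A = y *m P *m Q by rewrite -mulmxA PQ.
by rewrite -(mulmxA _ Q) QQ' mulmx1.
Qed.

Lemma right_kernel_base m n (A : 'M[K]_(m, n)) :
  exists (C : 'M[K]_(n, n - \rank A)) (C' : 'M[K]_(n - \rank A, n)),
  [/\ C' *m C = 1%:M, A *m C = 0 &
   forall k (x : 'M[K]_(n, k)), A *m x = 0 -> C *m (C' *m x) = x].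
Proof.
have := left_kernel_base A^T; rewrite mxrank_tr => -[D [D' [DD' DA DP]]].
exists D^T, D'^T; split.
- by rewrite -trmx_mul DD' trmx1.
- by apply: trmx_inj; rewrite trmx_mul trmxK DA trmx0.
move=> k x Ax; apply: trmx_inj; rewrite !trmx_mul !trmxK DP //.
by rewrite -trmx_mul Ax trmx0.
Qed.

Section Def.
Variables (m p q n : nat) (A : 'M[K]_(m, p)) (B : 'M[K]_(q, n)).
Definition sandwich (h : 'M[K]_(p, q)) : 'M[K]_(m, n) := A *m h *m B.
Lemma sandwich_linear : linear sandwich.
Proof. by move=> c g h; rewrite /sandwich mulmxDr mulmxDl -scalemxAr -scalemxAl. Qed.
HB.instance Definition _ :=
  GRing.isLinear.Build K 'M[K]_(p, q) 'M[K]_(m, n) _ sandwich sandwich_linear.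
End Def.

Lemma dim_mx i j : \dim {:'M[K]_(i, j)} = (i * j)%N.
Proof. by rewrite dimvf. Qed.

(** With full rank factorizations A = P1 Q1 and B = P2 Q2, the condition
    A h B = 0 amounts to Q1 h P2 = 0, and h |-> Q1 h P2 is onto the matrices of
    size rk A by rk B. *)
Lemma dim_ker_sandwich m p q n (A : 'M[K]_(m, p)) (B : 'M[K]_(q, n)) :
  (\dim (lker (linfun (sandwich A B))) + \rank A * \rank B = p * q)%N.
Proof.
have [P1 [Q1 [P1' [Q1' [EA P1K Q1K]]]]] := rank_factorization A.
have [P2 [Q2 [P2' [Q2' [EB P2K Q2K]]]]] := rank_factorization B.
pose S := linfun (sandwich Q1 P2).
have -> : lker (linfun (sandwich A B)) = lker S.
  apply/vspaceP => h; rewrite !memv_ker !lfunE /= /sandwich.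
  have E : A *m h *m B = P1 *m (Q1 *m h *m P2) *m Q2 by rewrite -{1}EA -{1}EB !mulmxA.
  rewrite E; apply/eqP/eqP => [E0|->]; last by rewrite mulmx0 mul0mx.
  have PQK X : P1' *m (P1 *m X *m Q2) *m Q2' = X.
    by rewrite !mulmxA P1K mul1mx -mulmxA Q2K mulmx1.
  by rewrite -[LHS]PQK E0 mulmx0 mul0mx.
rewrite -(dim_mx p q) -(limg_ker_dim S fullv) capfv; congr (_ + _)%N.
rewrite -dim_mx; congr (\dim _); apply/esym/vspaceP => h.
rewrite memvf; apply/memv_imgP.
exists (Q1' *m h *m P2'); rewrite ?memvf // lfunE /= /sandwich !mulmxA Q1K mul1mx.
by rewrite -mulmxA P2K mulmx1.
Qed.
End Sandwich.

Section Stabilizer.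
Variable K : fieldType.

(** Subspaces are row spaces, so that matrices act on row vectors from the
    right.  For phi and U the transposes of the endomorphism and of the morphism
    of a point X, the kernel of this map is the endomorphism algebra of X. *)
Definition stab_map m n (phi : 'M[K]_n) (U : 'M[K]_(m, n)) (h : 'M[K]_n) :
    'M[K]_n * 'M[K]_(m, n) :=
  (phi *m h - h *m phi, U *m h *m cokermx U).

Lemma stab_map_linear m n (phi : 'M[K]_n) (U : 'M[K]_(m, n)) : linear (stab_map phi U).
Proof.
move=> c g h; rewrite /stab_map; congr (_, _).
  by rewrite mulmxDl !mulmxDr -!scalemxAl -!scalemxAr opprD addrACA -scalerBr.
by rewrite mulmxDr mulmxDl -scalemxAr -scalemxAl.
Qed.
HB.instance Definition _ m n phi U :=
  GRing.isLinear.Build K 'M[K]_n ('M[K]_n * 'M[K]_(m, n))%type _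
    (@stab_map m n phi U) (stab_map_linear phi U).

Definition stab m n (phi : 'M[K]_n) (U : 'M[K]_(m, n)) : {vspace 'M[K]_n} :=
  lker (linfun (stab_map phi U)).

Lemma stabP m n (phi : 'M[K]_n) (U : 'M[K]_(m, n)) h :
  reflect (phi *m h = h *m phi /\ (U *m h <= U)%MS) (h \in stab phi U).
Proof.
rewrite memv_ker lfunE /= submxE; apply: (iffP eqP) => [[/eqP + ->]|[E /eqP E']].
  by rewrite subr_eq0 => /eqP.
by rewrite /stab_map E E' subrr.
Qed.

Section Step.
(* A full rank factorization phi = P Q identifies the image of phi, which is
   the row space of Q, with the row vectors of size r.  On these, phi acts as
   Q P. *)
Variables (m n r : nat) (phi : 'M[K]_n) (U : 'M[K]_(m, n)).
Variables (P : 'M[K]_(n, r)) (Q : 'M[K]_(r, n)) (P' : 'M[K]_(r, n)) (Q' : 'M[K]_(n, r)).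
Hypothesis U_phi : U *m phi = 0.
Hypotheses (PQ : P *m Q = phi) (P'P : P' *m P = 1%:M) (QQ' : Q *m Q' = 1%:M).

Definition im_endo : 'M[K]_r := Q *m P.
Definition im_sub : 'M[K]_(n, r) := (U :&: phi)%MS *m Q'.

Lemma rfactor_free : row_free Q. Proof. by apply/row_freeP; exists Q'. Qed.

Lemma rfactor_eqmx : (Q :=: phi)%MS.
Proof.
apply/eqmxP; rewrite -{2}PQ submxMl andbT; apply/submxP.
by exists P'; rewrite -PQ mulmxA P'P mul1mx.
Qed.

Lemma rank_factored : \rank phi = r.
Proof. by rewrite -rfactor_eqmx; apply/eqP; apply: rfactor_free. Qed.

Lemma rfactorK k (A : 'M[K]_(k, n)) : (A <= phi)%MS -> A *m Q' *m Q = A.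
Proof. by rewrite -rfactor_eqmx => /submxP[D ->]; rewrite -(mulmxA D) QQ' mulmx1. Qed.

Lemma rfactor_inj k (A B : 'M[K]_(k, r)) : A *m Q = B *m Q -> A = B.
Proof. by move=> E; rewrite -[A]mulmx1 -[B]mulmx1 -QQ' !mulmxA E. Qed.

Lemma lfactor_inj k (A B : 'M[K]_(r, k)) : P *m A = P *m B -> A = B.
Proof. by move=> E; rewrite -[A]mul1mx -[B]mul1mx -P'P -!mulmxA E. Qed.

Lemma rfactor_endo : Q *m phi = im_endo *m Q.
Proof. by rewrite -PQ mulmxA. Qed.

Lemma im_subE : im_sub *m Q = (U :&: phi)%MS.
Proof. by rewrite rfactorK // capmxSr. Qed.

(** A matrix commuting with [phi] preserves the image of [phi]; [Q *m h *m Q']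
    is its restriction, written in the basis of the rows of [Q]. *)
Lemma rfactor_stab h : h \in stab phi U -> Q *m h = Q *m h *m Q' *m Q.
Proof.
move=> /stabP[hphi _]; rewrite rfactorK //.
have [D ->] : exists D, Q = D *m phi by apply/submxP; rewrite rfactor_eqmx.
by rewrite -mulmxA hphi mulmxA submxMl.
Qed.

Lemma restr_stab h : h \in stab phi U -> Q *m h *m Q' \in stab im_endo im_sub.
Proof.
move=> hS; have := rfactor_stab hS; have /stabP[hphi hU] := hS.
move: (Q *m h *m Q') => h' hQ; apply/stabP; split.
  apply: rfactor_inj; rewrite -(mulmxA im_endo) -hQ -(mulmxA h') -rfactor_endo.
  by rewrite (mulmxA im_endo) -rfactor_endo -mulmxA hphi !mulmxA hQ.
rewrite -(submxMfree _ _ rfactor_free) -mulmxA -hQ mulmxA im_subE.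
rewrite sub_capmx (submx_trans (submxMr _ (capmxSl _ _)) hU) /=.
by apply: submx_trans (submxMr _ (capmxSr _ _)) _; rewrite hphi submxMl.
Qed.

(** Let C be a complement of U cap im phi in U, and A0 a complement of
    im phi + C.  An extension h of h' is given by h' on im phi, by 0 on C, and
    on A0 by a choice of preimages under phi of the vectors h' (phi v).  Then
    phi and h commute on A0 by construction and on C since phi vanishes there,
    and U is preserved since U is the sum of C and U cap im phi. *)
Lemma restr_surj h' : h' \in stab im_endo im_sub ->
  exists2 h, h \in stab phi U & Q *m h *m Q' = h'.
Proof.
case/stabP=> h'phi h'U.
pose C : 'M[K]_n := (U :\: phi)%MS.
have phiC : (phi :&: C = 0)%MS.
  by apply/eqP; rewrite -submx0 capmxC capmx_diff.
have Cphi : (C :&: phi = 0)%MS by rewrite capmxC.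
pose A : 'M[K]_n := (phi + C)%MS.
have AAC : (A :&: A^C = 0)%MS by apply: capmx_compl.
have ACA : (A^C :&: A = 0)%MS by rewrite capmxC.
pose p0 := proj_mx A^C%MS A; pose q := proj_mx A A^C%MS.
pose pQ := q *m proj_mx phi C; pose p1 := q *m proj_mx C phi.
have subA k (B : 'M[K]_(k, n)) : (B <= A -> B *m q = B /\ B *m p0 = 0)%MS.
  by move=> BA; rewrite /q /p0 proj_mx_id // proj_mx_0.
have p_sum : pQ + p1 + p0 = 1%:M.
  rewrite /pQ /p1 add_proj_mx //; last by rewrite -[q]mul1mx proj_mx_sub.
  rewrite -[q]mul1mx -[p0]mul1mx add_proj_mx //.
  by apply: submx_full; apply: addsmx_compl_full.
have QA : (Q <= A)%MS by rewrite rfactor_eqmx addsmxSl.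
have CA : (C <= A)%MS by apply: addsmxSr.
have [Qq Qp0] := subA _ _ QA; have [Cq Cp0] := subA _ _ CA.
have QpQ : Q *m pQ = Q by rewrite mulmxA Qq proj_mx_id ?rfactor_eqmx.
have CpQ : C *m pQ = 0 by rewrite mulmxA Cq proj_mx_0.
have pQ_phi : (pQ <= phi)%MS by apply: proj_mx_sub.
have p1P : p1 *m P = 0.
  apply: rfactor_inj; rewrite -mulmxA PQ mul0mx; apply: sub_kermxP.
  apply: submx_trans (proj_mx_sub _ _ _) _; apply: submx_trans (diffmxSl _ _) _.
  exact/sub_kermxP.
clearbody pQ p1 p0 q.
pose h0 := P *m h' *m Q *m pinvmx phi.
have h0phi : h0 *m phi = P *m h' *m Q.
  by rewrite mulmxKpV // -rfactor_eqmx submxMl.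
pose h := pQ *m Q' *m h' *m Q + p0 *m h0.
have Qh : Q *m h = h' *m Q.
  by rewrite mulmxDr !mulmxA QpQ QQ' mul1mx Qp0 !mul0mx addr0.
have Ch : C *m h = 0 by rewrite mulmxDr !mulmxA CpQ Cp0 !mul0mx addr0.
exists h; last by rewrite Qh -mulmxA QQ' mulmx1.
apply/stabP; split.
  rewrite -{1}PQ -mulmxA Qh mulmxDl -(mulmxA p0) h0phi.
  have -> : pQ *m Q' *m h' *m Q *m phi = pQ *m (P *m h' *m Q).
    rewrite -!mulmxA rfactor_endo (mulmxA h') -h'phi /im_endo !mulmxA.
    by rewrite (rfactorK pQ_phi).
  rewrite -mulmxDl; have -> : pQ + p0 = 1%:M - p1 by rewrite -p_sum addrAC addrK.
  by rewrite mulmxBl mul1mx !mulmxA p1P !mul0mx subr0.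
have UE : (U <= C + (U :&: phi))%MS.
  by rewrite addsmx_diff_cap_eq.
apply: submx_trans (submxMr _ UE) _; rewrite addsmxMr Ch adds0mx.
rewrite -im_subE -mulmxA Qh mulmxA; apply: submx_trans (submxMr _ h'U) _.
by rewrite im_subE capmxSl.
Qed.

(** The kernel of the restriction to the image of phi consists of the h that
    vanish on im phi and take values in ker phi.  They correspond to square
    matrices k of size n - r, through bases of the cokernel and of the kernel,
    and h preserves U if and only if a product of the form A k B vanishes, where
    A has the rank of the class of U in the cokernel and B the codimension of U in
    the kernel. *)
Lemma dim_stab_step :
  (\dim (stab phi U) + (\rank U - \rank (U :&: phi)) * (n - r - \rank U) =
   \dim (stab im_endo im_sub) + (n - r) * (n - r))%N.
Proof.
pose rho := linfun (sandwich Q Q').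
have img_rho : (rho @: stab phi U = stab im_endo im_sub)%VS.
  apply/vspaceP => h'; apply/memv_imgP/idP => [[h hS ->]|/restr_surj[h hS <-]].
    by rewrite lfunE /=; apply: restr_stab.
  by exists h; rewrite // lfunE.
have [C [C' [C'C phiC CP]]] := right_kernel_base phi.
have [D [D' [DD' Dphi DP]]] := left_kernel_base phi.
rewrite rank_factored in C C' C'C phiC CP D D' DD' Dphi DP.
pose theta := linfun (sandwich C D).
pose S := linfun (sandwich (U *m C) (D *m cokermx U)).
have theta_inj h : sandwich C D h = 0 -> h = 0.
  move=> /(congr1 (sandwich C' D')); rewrite linear0 => <-.
  by rewrite /sandwich !mulmxA C'C mul1mx -mulmxA DD' mulmx1.
have kerE : (stab phi U :&: lker rho = theta @: lker S)%VS.
  apply/vspaceP => h; rewrite memv_cap (memv_ker rho) lfunE /=.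
  apply/andP/memv_imgP => [[hS /eqP rho0]|[k kS ->]].
    have Qh : Q *m h = 0 by rewrite (rfactor_stab hS) -[_ *m Q']/(sandwich Q Q' h) rho0 mul0mx.
    have /stabP[hphi hU] := hS.
    have phih : phi *m h = 0 by rewrite -PQ -mulmxA Qh mulmx0.
    have hphi0 : h *m phi = 0 by rewrite -hphi.
    have hE : h = sandwich C D (C' *m h *m D').
      by rewrite /sandwich mulmxA CP // DP.
    exists (C' *m h *m D'); last by rewrite lfunE.
    move: hU; rewrite memv_ker lfunE /= submxE {1}hE => /eqP E; apply/eqP.
    by move: E; rewrite /sandwich !mulmxA.
  rewrite lfunE /=; move: kS; rewrite memv_ker lfunE /= => /eqP kS.
  have QC : Q *m C = 0 by apply: lfactor_inj; rewrite mulmxA PQ phiC mulmx0.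
  split; last by rewrite /sandwich !mulmxA QC !mul0mx.
  apply/stabP; split; first by rewrite /sandwich -!mulmxA Dphi !mulmxA phiC !mul0mx mulmx0.
  by rewrite submxE; apply/eqP; move: kS; rewrite /sandwich !mulmxA.
have dim_ker : \dim (stab phi U :&: lker rho) = \dim (lker S).
  rewrite kerE limg_dim_eq //; apply/vspaceP => h.
  rewrite memv_cap memv0 !memv_ker !lfunE /=.
  apply/andP/eqP => [[_ /eqP/theta_inj]//|->].
  by rewrite !linear0.
have rank_UC : \rank (U *m C) = (\rank U - \rank (U :&: phi))%N.
  have := mxrank_mul_ker U C; suff kerC : (kermx C :=: phi)%MS.
    by rewrite (cap_eqmx (eqmx_refl _) kerC); lia.
  apply/eqmx_sym/eqmxP; rewrite -mxrank_leqif_eq; last exact/sub_kermxP.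
  have rC : \rank C = (n - r)%N.
    by apply/eqP; rewrite -[_ == _]/(row_full C); apply/row_fullP; exists C'.
  by rewrite mxrank_ker rC rank_factored subKn // -rank_factored rank_leq_row.
have rank_DU : \rank (D *m cokermx U) = (n - r - \rank U)%N.
  have := mxrank_mul_ker D (cokermx U).
  have -> : \rank D = (n - r)%N.
    by apply/eqP; rewrite -[_ == _]/(row_free D); apply/row_freeP; exists D'.
  have kerU : (kermx (cokermx U) :=: U)%MS.
    apply/eqmxP; rewrite submxE mulmx_ker eqxx /=.
    by apply/sub_kermxP; rewrite mulmx_coker.
  have UD : (D :&: U :=: U)%MS.
    apply/capmx_idPr; rewrite -(DP _ _ U_phi); exact: submxMl.
  by rewrite (cap_eqmx (eqmx_refl _) kerU) UD; lia.
rewrite -(limg_ker_dim rho (stab phi U)) img_rho dim_ker.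
have := dim_ker_sandwich (U *m C) (D *m cokermx U).
by rewrite rank_UC rank_DU -/S => <-; rewrite addnAC addnC.
Qed.

Lemma im_endoX i : P *m im_endo ^+ i *m Q = phi ^+ i.+1.
Proof.
elim: i => [|i IHi]; first by rewrite expr0 mulmx1 expr1.
rewrite (exprSr phi) (exprSr im_endo) -[im_endo ^+ i * _]/(_ *m _).
by rewrite -[phi ^+ _ * _]/(_ *m _) -IHi (mulmxA P) -(mulmxA _ im_endo) -rfactor_endo mulmxA.
Qed.

Lemma rank_im_endoX i : \rank (im_endo ^+ i) = \rank (phi ^+ i.+1).
Proof.
rewrite -im_endoX mxrankMfree ?rfactor_free // eqmxMfull //.
by apply/row_fullP; exists P'.
Qed.

Lemma rank_im_sub_cap i : \rank (im_sub :&: im_endo ^+ i)%MS = \rank (U :&: phi ^+ i.+1)%MS.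
Proof.
rewrite -(mxrankMfree (im_sub :&: _)%MS rfactor_free); apply/eqmx_rank.
have P_full : row_full P by apply/row_fullP; exists P'.
have E : (im_endo ^+ i *m Q :=: phi ^+ i.+1)%MS.
  by rewrite -im_endoX -mulmxA; apply/eqmx_sym/eqmxMfull.
rewrite sub_capmx.
apply/andP; split.
  apply/andP; split.
    apply: submx_trans (submxMr _ (capmxSl _ _)) _.
    by rewrite im_subE capmxSl.
  by rewrite -E submxMr // capmxSr.
have sub_phi : (U :&: phi ^+ i.+1 <= phi)%MS.
  by apply: submx_trans (capmxSr _ _) _; rewrite -im_endoX -mulmxA -rfactor_eqmx mulmxA submxMl.
rewrite -(rfactorK sub_phi) submxMr // sub_capmx.
rewrite -!(submxMfree _ _ rfactor_free) (rfactorK sub_phi) im_subE sub_capmx capmxSl sub_phi /=.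
by rewrite E capmxSr.
Qed.

End Step.

Definition rank_drop n (phi : 'M[K]_n) i := (\rank (phi ^+ i) - \rank (phi ^+ i.+1))%N.
Definition cap_rank m n (phi : 'M[K]_n) (U : 'M[K]_(m, n)) i := \rank (U :&: phi ^+ i)%MS.

(** Iteration of [dim_stab_step]: replacing phi by its restriction to its image
    shifts the ranks of the powers and the dimensions of the intersections
    with U by one index. *)
Lemma dim_stab N m n (phi : 'M[K]_n) (U : 'M[K]_(m, n)) :
  U *m phi = 0 -> phi ^+ N = 0 ->
  (\dim (stab phi U) + \sum_(i < N) (cap_rank phi U i - cap_rank phi U i.+1) *
       (rank_drop phi i - cap_rank phi U i) =
   \sum_(i < N) rank_drop phi i * rank_drop phi i)%N.
Proof.
elim: N m n phi U => [|N IHN] m n phi U Uphi phiN.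
  have n0 : n = 0%N.
    case: n phi U Uphi phiN => // n phi U _ /eqP.
    by rewrite expr0 oner_eq0.
  rewrite !big_ord0 addn0; apply/eqP; rewrite -leqn0.
  by apply: leq_trans (dimvS (subvf _)) _; rewrite dim_mx n0.
have [P [Q [P' [Q' [PQ P'P QQ']]]]] := rank_factorization phi.
have step := dim_stab_step Uphi PQ P'P QQ'.
have U'phi' : im_sub phi U Q' *m im_endo P Q = 0.
  apply: (rfactor_inj QQ'); rewrite mul0mx -mulmxA -(rfactor_endo PQ) mulmxA (im_subE U PQ P'P QQ').
  by apply/sub_kermxP; apply: submx_trans (capmxSl _ _) _; apply/sub_kermxP.
have phi'N : im_endo P Q ^+ N = 0.
  apply: (rfactor_inj QQ'); apply: (lfactor_inj P'P).
  by rewrite mulmxA (im_endoX PQ) phiN mul0mx mulmx0.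
have IH := IHN _ _ _ _ U'phi' phi'N.
rewrite !big_ord_recl /=.
have dropE i : rank_drop (im_endo P Q) i = rank_drop phi i.+1.
  by rewrite /rank_drop !(rank_im_endoX PQ P'P QQ').
have capE i : cap_rank (im_endo P Q) (im_sub phi U Q') i = cap_rank phi U i.+1.
  by rewrite /cap_rank (rank_im_sub_cap _ PQ P'P QQ').
have drop0 : rank_drop phi 0 = (n - \rank phi)%N.
  by rewrite /rank_drop expr0 expr1 mxrank1.
have cap0 : cap_rank phi U 0 = \rank U.
  by rewrite /cap_rank expr0 (capmx_idPl (submx1 U)).
have cap1 : cap_rank phi U 1 = \rank (U :&: phi)%MS by rewrite /cap_rank expr1.
rewrite drop0 cap0 cap1.
have -> : (\sum_(i < N) rank_drop phi (bump 0 i) * rank_drop phi (bump 0 i) =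
   \sum_(i < N) rank_drop (im_endo P Q) i * rank_drop (im_endo P Q) i)%N.
  by apply: eq_bigr => i _; rewrite dropE.
rewrite -IH.
set T := (\sum_(i < N) _)%N; set T' := (\sum_(i < N) _)%N.
have -> : T = T' by apply: eq_bigr => i _; rewrite dropE !capE.
by move: step; lia.
Qed.
End Stabilizer.

(** * The dimensions of T^i M *)

Section Profile.
Variable K : fieldType.

(** [r] is the dimension over [K] of the submodule T^i M, expressed by a linear
    parametrization [e] of it by [K]^r. *)
Definition dim_mulXn (M : lmodType {poly K}) (i r : nat) : Prop :=
  exists e : 'rV[K]_r -> M,
    [/\ forall c u v, e (c *: u + v) = c%:P *: e u + e v,
        injective e &
        forall y, (exists x, y = 'X^i *: x) <-> exists v, y = e v].

Lemma dim_mulXn_iso (M N : lmodType {poly K}) i r :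
  lmod_iso M N -> dim_mulXn M i r -> dim_mulXn N i r.
Proof.
move=> [u [u' uK u'K]] [e [elin einj eP]]; exists (u \o e); split.
- by move=> c v w; rewrite /= elin linearP.
- by apply: inj_comp einj; apply: can_inj uK.
move=> y; split=> [[x ->]|[v ->]].
  have [v Ev] := (eP ('X^i *: u' x)).1 (ex_intro _ _ erefl).
  by exists v; rewrite /= -Ev linearZ /= u'K.
have [x Ex] := (eP (e v)).2 (ex_intro _ _ erefl).
by exists (u x); rewrite /= Ex linearZ.
Qed.

Lemma dim_mulXn_le (M : lmodType {poly K}) i r s :
  dim_mulXn M i r -> dim_mulXn M i s -> (r <= s)%N.
Proof.
move=> [e [elin einj eP]] [e' [e'lin e'inj e'P]].
have [w wE] : exists w : 'I_r -> 'rV[K]_s, forall j, e (delta_mx 0 j) = e' (w j).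
  apply: (@fin_all_exists _ _ (fun j w => e (delta_mx 0 j) = e' w)) => j.
  by apply/e'P/eP; exists (delta_mx 0 j).
pose A := \matrix_j w j.
have lin0 (V : lmodType K) (f : V -> M) :
    (forall c u v, f (c *: u + v) = c%:P *: f u + f v) -> f 0 = 0.
  move=> flin; have := flin 1 0 0; rewrite scaler0 add0r scale1r => /eqP.
  by rewrite -subr_eq subrr eq_sym => /eqP.
have AE u : e' (u *m A) = e u.
  rewrite mulmx_sum_row [in RHS](row_sum_delta u).
  elim: (index_enum _) => [|j t IHt]; first by rewrite !big_nil !lin0.
  by rewrite !big_cons e'lin elin IHt wE rowK.
suff /eqP <- : row_free A by apply: rank_leq_col.
rewrite -kermx_eq0; apply/eqP/row_matrixP => j; rewrite row0.
have := row_sub j (kermx A) => /sub_kermxP; move: (row j _) => u uA.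
by apply: einj; rewrite -AE uA !lin0.
Qed.

Lemma dim_mulXn_uniq (M : lmodType {poly K}) i r s :
  dim_mulXn M i r -> dim_mulXn M i s -> r = s.
Proof.
by move=> Mr Ms; apply/eqP; rewrite eqn_leq (dim_mulXn_le Mr Ms) (dim_mulXn_le Ms Mr).
Qed.

Lemma dvdp_Xn_small m i (p : {poly K}) :
  (size p <= m - i)%N -> 'X^m %| 'X^i * p -> p = 0.
Proof.
move=> sp; apply: contraTeq => p0; rewrite gtNdvdp ?mulf_neq0 //.
  by rewrite monic_neq0 ?monicXn.
rewrite mulrC size_mulXn // size_polyXn; move: p0; rewrite -size_poly_gt0.
by move: (size p) sp => s; lia.
Qed.

(** The multiples of T^i in K[T] / (T^m) are the classes of the T^i q with [q]
    of degree less than m - i. *)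
Lemma dim_mulXn_cyclic m i : dim_mulXn (qmod (@idealX K m)) i (m - i).
Proof.
exists (fun v => qmod_pi (@idealX K m) ('X^i * rVpoly v : {poly K}^o)); split.
- by move=> c u v; rewrite linearP /= mulrDr -scalerAr -mul_polyC linearP.
- move=> u v /qmod_piP; rewrite unfold_in -mulrBr -raddfB /= => dvd.
  apply/eqP; rewrite -subr_eq0; move: (u - v) dvd => {u v}w dvd.
  have w0 : rVpoly w = 0 by apply: dvdp_Xn_small dvd; apply: size_poly.
  by rewrite -[w]rVpolyK w0 linear0.
move=> y; split=> [[x]|[v ->]].
  elim/qmod_piW: x => p ->; pose q := (p : {poly K}) %% 'X^(m - i).
  have sq : (size q <= m - i)%N.
    by rewrite -ltnS -(size_polyXn K (m - i)) ltn_modpN0 // monic_neq0 ?monicXn.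
  exists (poly_rV q); rewrite poly_rV_K //.
  rewrite -linearZ; apply/qmod_piP; rewrite unfold_in -mulrBr.
  rewrite {1}(divp_eq p 'X^(m - i)) addrK mulrCA dvdp_mull // -exprD.
  by rewrite dvdp_exp2l //; lia.
exists (qmod_pi (@idealX K m) (rVpoly v : {poly K}^o)).
by rewrite -linearZ.
Qed.

Lemma dim_mulXn_Nmod lambda i :
  dim_mulXn (Nmod K lambda) i (\sum_(m <- lambda) (m - i))%N.
Proof.
elim: lambda => [|m lambda [e2 [e2lin e2inj e2P]]].
  rewrite big_nil; exists (fun=> 0); split.
  - by move=> *; rewrite scaler0 addr0.
  - by move=> u v _; rewrite (thinmx0 u) (thinmx0 v).
  move=> y; have all0 (z : 'rV[{poly K}]_0) : z = 0 by rewrite thinmx0.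
  by split=> _; exists 0; exact: etrans (all0 _) (esym (all0 _)).
rewrite big_cons; have [e1 [e1lin e1inj e1P]] := dim_mulXn_cyclic m i.
exists (fun v => (e1 (lsubmx v), e2 (rsubmx v))); split.
- by move=> c u v; rewrite !linearP /= e1lin e2lin.
- by move=> u v [/e1inj eql /e2inj eqr]; rewrite -[u]hsubmxK eql eqr hsubmxK.
move=> [y1 y2]; split=> [[[x1 x2] [-> ->]]|[v [-> ->]]].
  have [v1 Ev1] := (e1P ('X^i *: x1)).1 (ex_intro _ _ erefl).
  have [v2 Ev2] := (e2P ('X^i *: x2)).1 (ex_intro _ _ erefl).
  by exists (row_mx v1 v2); rewrite row_mxKl row_mxKr -Ev1 -Ev2.
have [x1 Ex1] := (e1P (e1 (lsubmx v))).2 (ex_intro _ _ erefl).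
have [x2 Ex2] := (e2P (e2 (rsubmx v))).2 (ex_intro _ _ erefl).
by exists (x1, x2); rewrite Ex1 Ex2.
Qed.

Lemma poly_mxC n (phi : 'M[K]_n) c : poly_mx phi c%:P = c%:M.
Proof.
rewrite (@poly_mx_widen _ _ _ 1) ?size_polyC_leq1 // big_ord1 expr0 coefC /=.
by rewrite -[1]/(1%:M) scalemx1.
Qed.

Lemma poly_mxXn n (phi : 'M[K]_n) i : poly_mx phi 'X^i = phi ^+ i.
Proof.
rewrite /poly_mx size_polyXn big_ord_recr /= big1 ?add0r; last first.
  by move=> j _; rewrite coefXn ltn_eqF // scale0r.
by rewrite coefXn eqxx scale1r.
Qed.

Lemma trmxX n (phi : 'M[K]_n) i : (phi ^+ i)^T = phi^T ^+ i.
Proof.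
elim: i => [|i IHi]; first by rewrite !expr0 trmx1.
by rewrite exprS exprSr -[_ * _]/(_ *m _) trmx_mul IHi.
Qed.

Lemma dim_mulXn_endmod n (phi : 'M[K]_n) i : dim_mulXn (endmod phi) i (\rank (phi^T ^+ i)).
Proof.
exists (fun v => (v *m row_base (phi^T ^+ i))^T : endmod phi); split.
- move=> c u v; rewrite mulmxDl linearD -scalemxAl linearZ /=.
  by rewrite [_ *: (_ : endmod phi)]endmod_scaleE poly_mxC mul_scalar_mx.
- move=> u v /trmx_inj/eqP; rewrite -subr_eq0 -mulmxBl => /eqP uv0.
  apply/eqP; rewrite -subr_eq0; apply/eqP.
  by apply: (row_free_inj (row_base_free (phi^T ^+ i))); rewrite uv0 mul0mx.
move=> y; split=> [[x ->]|[v ->]].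
  have /submxP[v Ev] : (((phi ^+ i *m (x : 'cV_n)) : 'cV_n)^T <= row_base (phi^T ^+ i))%MS.
    by rewrite eq_row_base trmx_mul trmxX submxMl.
  by exists v; rewrite -Ev trmxK endmod_scaleE poly_mxXn.
have /submxP[x Ex] : (v *m row_base (phi^T ^+ i) <= phi^T ^+ i)%MS.
  by apply: submx_trans (submxMl _ _) _; rewrite eq_row_base.
exists x^T; by rewrite Ex endmod_scaleE poly_mxXn trmx_mul -trmxX trmxK.
Qed.

(** The image of T^i in the cokernel N / U is parametrized by a complement of U
    cap im phi^i in im phi^i. *)
Lemma dim_mulXn_coker a b (X : aVb K a b) i :
  dim_mulXn (coker X) i
    (\rank ((endo X)^T ^+ i) - \rank ((mor X)^T :&: (endo X)^T ^+ i)%MS).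
Proof.
pose U := (mor X)^T; pose F := (endo X)^T ^+ i; pose B := (F :\: U)%MS.
have -> : (\rank F - \rank (U :&: F)%MS)%N = \rank B.
  by rewrite capmxC -(mxrank_cap_compl F U) addKn.
have BF : (row_base B <= F)%MS by rewrite eq_row_base diffmxSl.
exists (fun v => qmod_pi (@im_mor K a b X) ((v *m row_base B)^T : endmod (endo X))); split.
- move=> c u v; rewrite mulmxDl linearD -scalemxAl linearZ /=.
  rewrite -[RHS]qmod_pi_linear; congr (qmod_pi (@im_mor K a b X) (_ + _)).
  by rewrite [RHS]endmod_scaleE poly_mxC mul_scalar_mx.
- move=> u v /qmod_piP; rewrite unfold_in -linearB trmxK -mulmxBl => subU.
  apply/eqP; rewrite -subr_eq0; apply/eqP.
  apply: (row_free_inj (row_base_free B)); rewrite mul0mx; apply/eqP.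
  rewrite -submx0 -(capmx_diff F U) sub_capmx subU andbT.
  by apply: submx_trans (submxMl _ _) _; rewrite eq_row_base.
move=> y; split=> [[x]|[v ->]].
  elim/qmod_piW: x => x ->.
  have : (((endo X) ^+ i *m (x : 'cV_b))^T <= F :\: U + F :&: U)%MS.
    by rewrite addsmx_diff_cap_eq trmx_mul trmxX submxMl.
  case/sub_addsmxP=> [[w1 w2] /= Ew].
  have /submxP[v Ev] : (w1 *m (F :\: U)%MS <= row_base B)%MS.
    by rewrite eq_row_base submxMl.
  exists v; rewrite -linearZ; apply/qmod_piP.
  rewrite endmod_scaleE poly_mxXn unfold_in.
  rewrite linearB /= trmxK Ew -Ev addrC addKr.
  exact: submx_trans (submxMl _ _) (capmxSr _ _).
have /submxP[x Ex] : (v *m row_base B <= F)%MS by apply: submx_trans (submxMl _ _) BF.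
exists (qmod_pi (@im_mor K a b X) (x^T : endmod (endo X))).
rewrite -linearZ Ex; congr qmod_pi.
by rewrite endmod_scaleE poly_mxXn trmx_mul /F -trmxX trmxK.
Qed.

End Profile.

(** * Partitions and their columns *)

Section Partitions.
Local Open Scope nat_scope.

Definition column (lambda : seq nat) i := \sum_(m <- lambda) (i < m).

Lemma sum_truncated_columns lambda i :
  \sum_(m <- lambda) (m - i) = column lambda i + \sum_(m <- lambda) (m - i.+1).
Proof.
rewrite /column -big_split /=; apply: eq_bigr => m _.
by case: ltnP; lia.
Qed.

Lemma sum_columns N lambda : all (fun m => m <= N) lambda ->
  \sum_(i < N) column lambda i = \sum_(m <- lambda) m.
Proof.
move=> /allP leN; rewrite exchange_big /= big_seq [RHS]big_seq.
apply: eq_bigr => m /leN lemN.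
rewrite -(big_mkord xpredT (fun i => nat_of_bool (i < m))).
rewrite (big_cat_nat _ lemN) //= [X in _ + X]big1_seq ?addn0; last first.
  by move=> i; rewrite mem_index_iota /= => /andP[le_mi _]; rewrite ltnNge le_mi.
rewrite (eq_big_nat _ _ (F2 := fun=> 1)); last by move=> i /andP[_ ->].
by rewrite sum_nat_const_nat subn0 muln1.
Qed.

Lemma npart_cons m lambda : npart (m :: lambda) = \sum_(k <- lambda) k + npart lambda.
Proof.
rewrite /npart big_ord_recl /= muln0 add0n (big_nth 0) big_mkord -big_split /=.
by apply: eq_bigr => i _; rewrite /bump /= add1n mulnS.
Qed.

(** Numbering the boxes of each column by 0, 1, 2, ... and adding up gives
    n(lambda) when done by rows.  The proof adds a largest part in front, which
    shifts the other rows down by one. *)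
Lemma npart_columns N lambda : sorted geq lambda -> all (fun m => m <= N) lambda ->
  npart lambda = \sum_(i < N) 'C(column lambda i, 2).
Proof.
elim: lambda => [|m lambda IHl] /=.
  by rewrite /npart big_ord0 big1 // => i _; rewrite /column big_nil.
move=> sorted_l /andP[_ allN]; rewrite npart_cons IHl //; last exact: path_sorted sorted_l.
rewrite -(sum_columns allN) -big_split /=; apply: eq_bigr => i _.
rewrite [in RHS]/column big_cons -/(column _ _).
case: ltnP => im; first by rewrite add1n binS bin1 addnC.
suff -> : column lambda i = 0 by [].
rewrite /column big1_seq // => k /andP[_ kl].
have /(order_path_min (fun x y z xy yz => leq_trans yz xy))/allP/(_ k kl) := sorted_l.
by rewrite /= => km; rewrite ltnNge (leq_trans km im).
Qed.

Lemma all_leq_truncated N lambda : \sum_(m <- lambda) (m - N) = 0 ->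
  all (fun m => m <= N) lambda.
Proof.
elim: lambda => //= m lambda IHl; rewrite big_cons => /eqP.
by rewrite addn_eq0 subn_eq0 => /andP[-> /eqP/IHl].
Qed.

End Partitions.

Lemma sqr_bin2 n : (n * n = 'C(n, 2) + 'C(n, 2) + n)%N.
Proof. by elim: n => // n IHn; rewrite binS bin1; lia. Qed.

Lemma binD2 m n : ('C(m + n, 2) = 'C(m, 2) + ('C(n, 2) + m * n))%N.
Proof. by have := sqr_bin2 (m + n); have := sqr_bin2 m; have := sqr_bin2 n; lia. Qed.

(** The identity holds term by term once [a] choose 2 and [b] are written as
    telescoping sums, of C(u_i, 2) - C(u_(i+1), 2) and of r_i - r_(i+1). *)
Lemma stab_dim_identity N a b (r u : nat -> nat) :
  (forall i, r i.+1 <= r i)%N -> (forall i, u i.+1 <= u i)%N ->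
  (forall i, u i <= r i - r i.+1)%N -> r 0%N = b -> r N = 0%N -> u 0%N = a -> u N = 0%N ->
  let s i := (r i - r i.+1)%N in let g i := (s i - (u i - u i.+1))%N in
  (\sum_(i < N) s i * s i =
   \sum_(i < N) (u i - u i.+1) * (s i - u i) +
   ('C(a, 2) + \sum_(i < N) 'C(s i, 2) + \sum_(i < N) 'C(g i, 2) + b))%N.
Proof.
move=> r_dec u_dec u_le <- rN <- uN s g.
have tele (w : nat -> nat) M : (forall i, w i.+1 <= w i)%N ->
    (w 0 = w M + \sum_(i < M) (w i - w i.+1))%N.
  move=> wdec; elim: M => [|M IHM]; first by rewrite big_ord0 addn0.
  by rewrite big_ord_recr /= addnCA subnKC // addnC.
have tele2 M : ('C(u 0, 2) = 'C(u M, 2) + \sum_(i < M) ('C(u i, 2) - 'C(u i.+1, 2)))%N.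
  by apply: (tele (fun i => 'C(u i, 2)) M) => i; apply: leq_bin2l.
rewrite (tele2 N) (tele r N) // uN rN !add0n -!big_split /=.
apply: eq_bigr => i _; rewrite /g -/(s i).
move: (u_le i) (u_dec i); rewrite -/(s i).
move: (s i) (u i) (u i.+1) => x y z.
move=> + zy; have [d ->] : exists d, y = (z + d)%N by exists (y - z)%N; rewrite subnKC.
move=> zdx.
have [e ->] : exists e, x = (z + d + e)%N by exists (x - (z + d))%N; rewrite subnKC.
have -> : (z + d - z = d)%N by rewrite addKn.
have -> : (z + d + e - (z + d) = e)%N by rewrite addKn.
have -> : (z + d + e - d = z + e)%N by lia.
have -> : ('C(z + d, 2) - 'C(z, 2) = 'C(d, 2) + z * d)%N by rewrite binD2 addKn.
rewrite !binD2.
have := sqr_bin2 z; have := sqr_bin2 d; have := sqr_bin2 e; lia.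
Qed.

(** * The dimension formula *)

Section EndoSpace.
Variables (K : closedFieldType) (a b : nat).

Definition endo_tr (t : 'M[K]_a * 'M[K]_b) : 'M[K]_b := t.2^T.

Lemma endo_tr_linear : linear endo_tr.
Proof. by move=> c s t; rewrite /endo_tr linearP. Qed.
HB.instance Definition _ :=
  GRing.isLinear.Build K ('M[K]_a * 'M[K]_b)%type 'M[K]_b _ endo_tr endo_tr_linear.

(** As [f] is injective, an endomorphism (g, h) is determined by h, and g exists
    if and only if h preserves the image of [f]. *)
Lemma dim_endo_space (f : 'M[K]_(b, a)) (phi : 'M[K]_b) :
  row_free f^T -> \dim (endo_space f phi) = \dim (stab phi^T f^T).
Proof.
move=> f_free; pose pi := linfun endo_tr.
have f_inj (g : 'M[K]_a) : f *m g = 0 -> g = 0.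
  move=> /(congr1 trmx); rewrite trmx_mul trmx0 => fg; apply: trmx_inj.
  by apply: (row_free_inj f_free); rewrite fg trmx0 mul0mx.
have <- : (pi @: endo_space f phi)%VS = stab phi^T f^T.
  apply/vspaceP => h; apply/memv_imgP/stabP => [[t /endo_spaceP[tf tphi] ->]|].
    rewrite lfunE /= /endo_tr -!trmx_mul tf tphi; split=> //.
    by rewrite trmx_mul submxMl.
  case=> hphi /submxP[g gE]; exists (g^T, h^T); last by rewrite lfunE /= /endo_tr trmxK.
  by apply/endo_spaceP; split; apply: trmx_inj; rewrite !trmx_mul !trmxK.
rewrite limg_dim_eq //; apply/vspaceP => t; rewrite memv_cap memv0 (memv_ker pi) lfunE /=.
apply/andP/eqP => [[/endo_spaceP[tf _] /eqP t2]|->]; last by rewrite mem0v linear0.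
have t20 : t.2 = 0 by apply: trmx_inj; rewrite trmx0.
rewrite [t]surjective_pairing t20; congr (_, _).
by apply: f_inj; rewrite -tf t20 mul0mx.
Qed.
End EndoSpace.

Section Ranks.
Variables (K : fieldType) (m n : nat) (phi : 'M[K]_n) (U : 'M[K]_(m, n)).

Lemma rankX_decr i : (\rank (phi ^+ i.+1) <= \rank (phi ^+ i))%N.
Proof. by rewrite exprS; apply: mxrankS; apply: submxMl. Qed.

Lemma cap_rank_decr i : (cap_rank phi U i.+1 <= cap_rank phi U i)%N.
Proof.
apply: mxrankS; apply: capmxS => //.
by rewrite exprS; apply: submxMl.
Qed.

Lemma cap_rank_le_rank i : (cap_rank phi U i <= \rank (phi ^+ i))%N.
Proof. by apply: mxrankS; apply: capmxSr. Qed.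

(** The drop of the rank is the dimension of the intersection of ker phi with
    im phi^i. *)
Lemma cap_rank_le_drop i : U *m phi = 0 -> (cap_rank phi U i <= rank_drop phi i)%N.
Proof.
move=> /sub_kermxP Uphi; rewrite /rank_drop -(mxrank_mul_ker (phi ^+ i) phi).
rewrite exprSr addKn; apply: mxrankS.
by rewrite sub_capmx capmxSr; apply: submx_trans (capmxSl _ _) Uphi.
Qed.
End Ranks.

Theorem theorem1p2 (K : closedFieldType) (a b : nat) (hab : (a <= b)%N)
    (X : aVb K a b) (alpha beta gamma : seq nat)
    (hX : assoc_triple X alpha beta gamma) :
  exists d : nat,
    krull_dim (@zariski_closed K a b) (gl_orbit X) d /\
    d%:Z = b%:Z ^+ 2 + a%:Z ^+ 2 - (npart alpha)%:Z - (npart beta)%:Z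
           - (npart gamma)%:Z - b%:Z.
Proof.
have [/and3P[/andP[alpha_sorted _] /andP[beta_sorted _] /andP[gamma_sorted _]]
  iso_alpha iso_beta iso_gamma] := hX.
exists (\dim (endo_space (mor X) (endo X))^C); split; first exact: krull_dim_orbit.
pose U := (mor X)^T; pose phi := (endo X)^T.
pose r i : nat := \rank (phi ^+ i); pose u : nat -> nat := cap_rank phi U.
have U_phi : U *m phi = 0 by rewrite -trmx_mul endo_mor trmx0.
have phi_b : phi ^+ b = 0 by rewrite -trmxX endo_nilp trmx0.
have U_free : row_free U by rewrite /row_free mxrank_tr mor_rank (minn_idPr hab).
have r_beta i : (\sum_(m <- beta) (m - i) = r i)%N.
  exact: dim_mulXn_uniq (dim_mulXn_iso iso_beta (dim_mulXn_Nmod K beta i))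
    (dim_mulXn_endmod (endo X) i).
have r_gamma i : (\sum_(m <- gamma) (m - i) = r i - u i)%N.
  exact: dim_mulXn_uniq (dim_mulXn_iso iso_gamma (dim_mulXn_Nmod K gamma i))
    (dim_mulXn_coker X i).
have r_alpha i : (\sum_(m <- alpha) (m - i) = \rank ((0 : 'M[K]_a)^T ^+ i))%N.
  exact: dim_mulXn_uniq (dim_mulXn_iso iso_alpha (dim_mulXn_Nmod K alpha i))
    (dim_mulXn_endmod (0 : 'M[K]_a) i).
have r0 : r 0%N = b by rewrite /r expr0 mxrank1.
have rb : r b = 0%N by rewrite /r phi_b mxrank0.
have u0 : u 0%N = a.
  by rewrite /u /cap_rank expr0 (capmx_idPl (submx1 U)); apply/eqP.
have ub : u b = 0%N.
  by apply/eqP; rewrite -leqn0 -rb; apply: cap_rank_le_rank.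
have col_beta i : column beta i = rank_drop phi i.
  have := sum_truncated_columns beta i; rewrite !r_beta => rE.
  by rewrite /rank_drop -/(r i) -/(r i.+1) rE addnK.
have u_drop i : (u i <= rank_drop phi i)%N by apply: cap_rank_le_drop.
have u_decr i : (u i.+1 <= u i)%N by apply: cap_rank_decr.
have col_gamma i : (column gamma i = rank_drop phi i - (u i - u i.+1))%N.
  have := sum_truncated_columns gamma i; rewrite !r_gamma.
  have := u_drop i; have := u_decr i; have := cap_rank_le_rank phi U i.+1.
  have := rankX_decr phi i; rewrite /rank_drop -/(r i) -/(r i.+1) -/(u i.+1).
  lia.
have npart_alpha : npart alpha = 'C(a, 2).
  have alpha1 : (\sum_(m <- alpha) (m - 1) = 0)%N by rewrite r_alpha expr1 trmx0 mxrank0.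
  rewrite (npart_columns alpha_sorted (all_leq_truncated alpha1)) big_ord1.
  have := sum_truncated_columns alpha 0; rewrite alpha1 addn0 => <-.
  by rewrite r_alpha expr0 mxrank1.
have npart_beta : (npart beta = \sum_(i < b) 'C(rank_drop phi i, 2))%N.
  rewrite (npart_columns (N := b) beta_sorted).
    by apply: eq_bigr => i _; rewrite col_beta.
  by apply: all_leq_truncated; rewrite r_beta.
have npart_gamma :
    (npart gamma = \sum_(i < b) 'C(rank_drop phi i - (u i - u i.+1), 2))%N.
  rewrite (npart_columns (N := b) gamma_sorted).
    by apply: eq_bigr => i _; rewrite col_gamma.
  by apply: all_leq_truncated; rewrite r_gamma rb.
have dimE : (\dim (endo_space (mor X) (endo X)) =
    npart alpha + npart beta + npart gamma + b)%N.
  rewrite dim_endo_space //; have := dim_stab U_phi phi_b.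
  rewrite (stab_dim_identity (rankX_decr phi) u_decr u_drop r0 rb u0 ub).
  rewrite npart_alpha npart_beta npart_gamma addnC => /addnI.
  exact.
have dimV : \dim {: ('M[K]_a * 'M[K]_b)%type} = (a * a + b * b)%N by rewrite dimvf.
have := dimvS (subvf (endo_space (mor X) (endo X))).
rewrite dimv_compl dimV dimE => le_dim.
rewrite -subzn // !expr2; lia.
Qed.
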